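(* Let $p\in\mathbb{N}$ and let $\mathbf{f}_1,\dots,\mathbf{f}_p$ be non-zero elements of $\ell^2(\Lambda,\mathcal{M}_n)$. Then $\{\mathcal{D}_{2N\lambda}\mathbf{f}_j\}_{\lambda\in\Lambda,\,1\le j\le p}$ is a matrix-valued discrete Bessel sequence of non-uniform shifts if and only if there exists a positive finite constant $b_0$ such that $$\left\|\mathcal{F}(\mathbf{f}_j)(x)\right\|_{\mathcal{M}_n}\le b_0\quad\text{for a.e. }x\in\Omega\text{ and every }j\in\{1,\dots,p\}.$$
   Context: Fix $n,N\in\mathbb{N}$ (positive integers) and an odd integer $r$ coprime to $N$ with $1\le r\le 2N-1$. Put $\Lambda=\{0,\frac{r}{N}\}+2\mathbb{Z}\subset\mathbb{R}$ and $\Omega=[0,\frac12)\cup[\frac N2,\frac{N+1}{2})$. $\mathcal{M}_n$ is the space of complex $n\times n$ matrices with norm $\|\mathbf{a}\|_{\mathcal{M}_n}=\big(\sum_{m,k=1}^n|a_{m,k}|^2\big)^{1/2}$. $\ell^2(\Lambda,\mathcal{M}_n)$ is the Hilbert space of maps $\mathbf{f}:\Lambda\to\mathcal{M}_n$ with $\sum_{\lambda\in\Lambda}\sum_{m,k=1}^n|f_{m,k}(\lambda)|^2<\infty$, with inner product $\langle\mathbf{f},\mathbf{g}\rangle=\sum_{\lambda\in\Lambda}\sum_{m,k=1}^n f_{m,k}(\lambda)\overline{g_{m,k}(\lambda)}$ and associated norm $\|\cdot\|_{\ell^2}$. $L^2(\Omega,\mathcal{M}_n)$ is the Hilbert space of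 $\mathcal{M}_n$-valued functions on $\Omega$ with entries in $L^2(\Omega)$ and inner product $\sum_{m,k}\int_\Omega F_{m,k}(x)\overline{G_{m,k}(x)}\,dx$. The Fourier transform $\mathcal{F}:\ell^2(\Lambda,\mathcal{M}_n)\to L^2(\Omega,\mathcal{M}_n)$ is defined entrywise by $\mathcal{F}(\mathbf{f})_{m,k}(x)=\sum_{\lambda\in\Lambda}f_{m,k}(\lambda)e^{2\pi i\lambda x}$ (convergence in $L^2(\Omega)$; $\{e^{2\pi i\lambda\cdot}\}_{\lambda\in\Lambda}$ is a complete orthonormal system of $L^2(\Omega)$). For $\lambda\in\Lambda$, the displacement operator $\mathcal{D}_{2N\lambda}$ on $\ell^2(\Lambda,\mathcal{M}_n)$ is $(\mathcal{D}_{2N\lambda}\mathbf{f})(\lambda')=\mathbf{f}(\lambda'-2N\lambda)$, $\lambda'\in\Lambda$. For non-zero $\mathbf{f}_1,\dots,\mathbf{f}_p\in\ell^2(\Lambda,\mathcal{M}_n)$, the collection $\{\mathcal{D}_{2N\lambda}\mathbf{f}_j\}_{\lambda\in\Lambda,\,1\le j\le p}$ is a matrix-valued discrete Bessel sequence of non-uniform shifts if there is $b\in(0,\infty)$ (a Bessel bound) with $\sum_{j=1}^p\sum_{\lambda\in\Lambda}|\langle\mathbf{f},\mathcal{D}_{2N\lambda}\mathbf{f}_j\rangle|^2\le b\|\mathbf{f}\|_{\ell^2}^2$ for all $\mathbf{f}\in\ell^2(\Lambda,\mathcal{M}_n)$. *)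

(* Defs.v *)
From HB Require Import structures.
From mathcomp Require Import all_boot all_order all_algebra finmap.
From mathcomp Require Import all_classical all_reals all_analysis.
From mathcomp.analysis Require Import showcase.summability.
From mathcomp Require Import complex ring.

Set Implicit Arguments.
Unset Strict Implicit.
Unset Printing Implicit Defensive.

Import Order.TTheory GRing.Theory Num.Theory.
Import numFieldNormedType.Exports.

Local Open Scope classical_set_scope.
Local Open Scope ring_scope.
Local Open Scope complex_scope.

Definition Lambda (R : realType) (N r : nat) : set R :=
  [set a + 2 * k%:~R | a in [set 0; r%:R / N%:R] & k in [set: int]].
Arguments Lambda : clear implicits.

Definition Omega (R : realType) (N : nat) : set R :=
  `[0, 1 / 2[ `|` `[N%:R / 2, (N%:R + 1) / 2[.
Arguments Omega : clear implicits.

Definition mxnorm (R : realType) (n : nat) (a : 'M[R[i]]_n) : R :=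
  Num.sqrt (\sum_(m < n) \sum_(k < n) Normc.normc (a m k) ^+ 2).

(* Below, [Lambda R N r] used as a type is the subtype of reals lying in it. *)

Definition ell2 (R : realType) (n N r : nat)
    (f : Lambda R N r -> 'M[R[i]]_n) : Prop :=
  (\esum_(l in [set: Lambda R N r])
     (\sum_(m < n) \sum_(k < n) Normc.normc (f l m k) ^+ 2)%:E < +oo)%E.

(* [sum] is the unordered sum: the limit of the partial sums along the directed
   set of finite subsets of the index type. The alias [R[i]^o] only serves to
   select the topology that the modulus puts on [R[i]]. *)
Definition ell2_inner (R : realType) (n N r : nat)
    (f g : Lambda R N r -> 'M[R[i]]_n) : R[i] :=
  sum (fun l => (\sum_(m < n) \sum_(k < n) f l m k * (g l m k)^*) : R[i]^o).

Definition ell2_norm (R : realType) (n N r : nat)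
    (f : Lambda R N r -> 'M[R[i]]_n) : R :=
  Num.sqrt (complex.Re (ell2_inner f f)).

Lemma Lambda_shift (R : realType) (N r : nat) (l l' : Lambda R N r) :
  val l' - (2 * N)%:R * val l \in Lambda R N r.
Proof.
have [a ha [j _ <-]] := set_mem (valP l).
have [b hb [k _ <-]] := set_mem (valP l').
have [q Eq] : exists q : int, N%:R * a = q%:~R :> R.
  have [N0|N0] := eqVneq (N%:R : R) 0; first by exists 0; rewrite N0 mul0r.
  case: ha => ->; first by exists 0; rewrite mulr0.
  by exists r%:Z; rewrite mulrC mulfVK.
apply/mem_set; exists b => //.
exists (k - (q + 2 * N%:Z * j)) => //.
have -> : (2 * N)%:R * (a + 2 * j%:~R) = 2 * (N%:R * a) + 4 * N%:R * j%:~R :> R.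
  by rewrite natrM; ring.
by rewrite Eq rmorphB rmorphD !rmorphM /=; ring.
Qed.

(* [displace l] is the operator D_{2 N l}. *)
Definition displace (R : realType) (n N r : nat) (l : Lambda R N r)
    (f : Lambda R N r -> 'M[R[i]]_n) : Lambda R N r -> 'M[R[i]]_n :=
  fun l' => f (exist _ (val l' - (2 * N)%:R * val l) (Lambda_shift l l')).

Definition expi (R : realType) (t : R) : R[i] := cos t +i* sin t.

Definition L2_Omega (R : realType) (N : nat) (F : R -> R[i]) : Prop :=
  [/\ measurable_fun (Omega R N) (fun x => complex.Re (F x)),
      measurable_fun (Omega R N) (fun x => complex.Im (F x)) &
      (\int[lebesgue_measure]_(x in Omega R N)
         (Normc.normc (F x) ^+ 2)%:E < +oo)%E].

(* The series sum_l c l * exp (2 pi i l x) converges unconditionally to F in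
   L^2(Omega). *)
Definition fourier_sum (R : realType) (N r : nat)
    (c : Lambda R N r -> R[i]) (F : R -> R[i]) : Prop :=
  L2_Omega N F /\
  (\int[lebesgue_measure]_(x in Omega R N)
     (Normc.normc (partial_sum
        (fun l : Lambda R N r => c l * expi (2 * pi * val l * x)) A - F x)
      ^+ 2)%:E)%E @[A --> totally] --> (0 : \bar R)%E.

(* An element of L^2(Omega) is represented by a function on R, of which only
   the almost everywhere class on Omega matters. [fourier f] picks such a
   representative of the L^2 sum, entry by entry; the default value 0 of [xget]
   is never used when f is in ell^2. *)
Definition fourier (R : realType) (n N r : nat)
    (f : Lambda R N r -> 'M[R[i]]_n) (x : R) : 'M[R[i]]_n :=
  \matrix_(m < n, k < n)
    xget (cst 0) [set F | fourier_sum (fun l => f l m k) F] x.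

Definition Bessel (R : realType) (n N r p : nat)
    (f : 'I_p -> Lambda R N r -> 'M[R[i]]_n) : Prop :=
  exists b : R, 0 < b /\
    forall g : Lambda R N r -> 'M[R[i]]_n, ell2 g ->
      (\sum_(j < p) \esum_(l in [set: Lambda R N r])
         (Normc.normc (ell2_inner g (displace l (f j))) ^+ 2)%:E
       <= (b * ell2_norm g ^+ 2)%:E)%E.

(* Main.v *)
Require Import Defs.
From mathcomp Require Import all_boot all_order all_algebra finmap.
From mathcomp Require Import all_classical all_reals all_analysis.
From mathcomp Require Import measurable_realfun.
From mathcomp.analysis Require Import showcase.summability.
From mathcomp Require Import complex ring lra zify.
Import Order.TTheory GRing.Theory Num.Theory.
Import numFieldNormedType.Exports.
Local Open Scope classical_set_scope.
Local Open Scope ring_scope.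

(** Write [e_t(x) = exp(2 pi i t x)] and [F] for the Fourier transform of [f].
    Everything rests on one identity. A finite combination of translates
    [h = sum_(l in A) a_l D_(2Nl) f] has transform [P F] with the multiplier
    [P = sum_(l in A) a_l e_(2Nl)], so that
      [||h||^2 = int_Omega |P|^2 ||F||^2]        ([norm_combine]),
    while [int_Omega |P|^2 = sum_(l in A) |a_l|^2] ([L2_multiplier]), because
    the numbers [2Nl] are pairwise distinct even integers and exponentials with
    such frequencies are orthonormal on [Omega].

    If [||F|| <= b0] almost everywhere, take [a_l = <g, D_(2Nl) f>]. Then
    [s = sum |a_l|^2] equals [<g, h>], so by Cauchy-Schwarz
    [s^2 <= ||g||^2 ||h||^2 <= ||g||^2 b0^2 s], and [s <= b0^2 ||g||^2]
    ([bessel_of_bounded]).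

    Conversely, a Bessel bound [b] gives by duality
    [int_Omega |P|^2 ||F||^2 <= b sum |a_l|^2] for every multiplier
    ([synthesis_bound]). The multiplier with [M] unimodular coefficients and
    frequencies [4Nk], [k < M], all in phase at a point [t], has modulus at
    least [M cos 1] on the ball of radius [1 / (8 pi N M)] around [t]
    ([multiplier_peak]). Hence the averages of [||F||^2] over these balls are
    bounded independently of [M] and [t], and Lebesgue's differentiation theorem
    bounds [||F||^2] almost everywhere ([bounded_of_bessel]).

    The identity itself comes from Parseval's formula for the series that define
    the transform ([parseval]), from the effect of a translation on such a
    series ([fourier_sum_shift]), and from the Riesz-Fischer theorem
    ([riesz_fischer]), which guarantees that the transform of a square-summable
    sequence exists. *)

Set Implicit Arguments.
Unset Strict Implicit.
Unset Printing Implicit Defensive.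
Local Notation sqn z := (Normc.normc z ^+ 2).
#[local] Existing Instance summability.totally_filter.

(** * Squared modulus and unit exponentials *)

Section SquaredModulus.
Context {R : realType}.
Implicit Types (z a b : R[i]) (e s t : R).

Lemma normc_ge0 z : 0 <= Normc.normc z.
Proof. by case: z => x y /=; exact: sqrtr_ge0. Qed.

Lemma normc_triangle a b :
  Normc.normc (a + b) <= Normc.normc a + Normc.normc b.
Proof.
have := ler_normD a b.
by rewrite !normc_def -rmorphD /= lecR; case: a b => [? ?] [? ?].
Qed.

Lemma sqnE z : sqn z = complex.Re z ^+ 2 + complex.Im z ^+ 2.
Proof. by case: z => x y /=; rewrite sqr_sqrtr// addr_ge0// sqr_ge0. Qed.

Lemma sqn_ge0 z : 0 <= sqn z. Proof. exact: sqr_ge0. Qed.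

Lemma sqn0 : sqn (0 : R[i]) = 0 :> R. Proof. by rewrite sqnE /= expr0n/= addr0. Qed.

Lemma sqnM a b : sqn (a * b) = sqn a * sqn b.
Proof. by rewrite Normc.normcM exprMn. Qed.

Lemma sqnN z : sqn (- z) = sqn z.
Proof. by rewrite !sqnE; case: z => x y /=; rewrite !sqrrN. Qed.

Lemma sqn_conj z : sqn (z^*) = sqn z.
Proof. by rewrite -[z^*]/(conjc z) !sqnE; case: z => x y /=; rewrite sqrrN. Qed.

Lemma sqn_real (x : R) : sqn (x%:C%C) = x ^+ 2.
Proof. by rewrite sqnE /= expr0n/= addr0. Qed.

Lemma mul_conjE z : z * z^* = (sqn z)%:C%C.
Proof.
rewrite -[z^*]/(conjc z) sqnE; case: z => x y; apply/eqP.
by rewrite eq_complex /=; apply/andP; split; apply/eqP; ring.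
Qed.

Lemma sqn_Re z : sqn z = complex.Re (z * z^*).
Proof. by rewrite mul_conjE. Qed.

Lemma Re_sum (I : Type) (r : seq I) (P : pred I) (F : I -> R[i]) :
  complex.Re (\sum_(i <- r | P i) F i) = \sum_(i <- r | P i) complex.Re (F i).
Proof. by elim/big_rec2: _ => // i x y _ <-; case: (F i) y => [? ?] []. Qed.

Lemma Im_sum (I : Type) (r : seq I) (P : pred I) (F : I -> R[i]) :
  complex.Im (\sum_(i <- r | P i) F i) = \sum_(i <- r | P i) complex.Im (F i).
Proof. by elim/big_rec2: _ => // i x y _ <-; case: (F i) y => [? ?] []. Qed.

Lemma conjc_sum (I : Type) (r : seq I) (P : pred I) (F : I -> R[i]) :
  (\sum_(i <- r | P i) F i)^* = \sum_(i <- r | P i) (F i)^*.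
Proof. exact: rmorph_sum. Qed.

(** Young's form of the triangle inequality: it lets squared norms be compared
    up to a factor [1 + e] without taking square roots. *)
Lemma sqnD_le e a b : 0 < e -> sqn (a + b) <= (1 + e) * sqn a + (1 + e^-1) * sqn b.
Proof.
move=> e0; rewrite !sqnE; case: a b => [x y] [u v] /=.
have real_case (p q : R) : (p + q) ^+ 2 <= (1 + e) * p ^+ 2 + (1 + e^-1) * q ^+ 2.
  rewrite -subr_ge0.
  have -> : (1 + e) * p ^+ 2 + (1 + e^-1) * q ^+ 2 - (p + q) ^+ 2 =
            e * (p - e^-1 * q) ^+ 2.
    by field; rewrite gt_eqF.
  by rewrite mulr_ge0 ?sqr_ge0// ltW.
have := lerD (real_case x u) (real_case y v); lra.
Qed.

(** Cauchy-Schwarz, by induction on the index sequence: with [A], [B] the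
    two sums so far and [u], [v] the moduli of the new terms, the step is
    [2 sqrt (A B) u v <= A v^2 + B u^2], and no division by a sum that may
    vanish occurs. *)
Lemma sqn_sum_CS (I : Type) (s : seq I) (F G : I -> R[i]) :
  sqn (\sum_(i <- s) F i * (G i)^*) <=
  (\sum_(i <- s) sqn (F i)) * (\sum_(i <- s) sqn (G i)).
Proof.
elim: s => [|i s]; first by rewrite !big_nil sqn0 mul0r.
rewrite !big_cons.
set z := \sum_(j <- s) _; set A := \sum_(j <- s) _; set B := \sum_(j <- s) _.
have A_ge0 : 0 <= A by apply: sumr_ge0 => j _; exact: sqn_ge0.
have B_ge0 : 0 <= B by apply: sumr_ge0 => j _; exact: sqn_ge0.
move=> IH.
set u := Normc.normc (F i); set v := Normc.normc (G i).
have nG : Normc.normc ((G i)^*) = v.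
  by apply/eqP; rewrite -(@eqrXn2 _ 2)// ?normc_ge0// sqn_conj.
have nz_ge0 := normc_ge0 z.
have u_ge0 : 0 <= u := normc_ge0 (F i).
have v_ge0 : 0 <= v := normc_ge0 (G i).
have cross : 2 * (Normc.normc z * (u * v)) <= A * v ^+ 2 + B * u ^+ 2.
  rewrite -(@ler_pXn2r _ 2)// ?nnegrE ?addr_ge0 ?mulr_ge0 ?sqr_ge0//.
  apply: (@le_trans _ _ (4 * ((A * v ^+ 2) * (B * u ^+ 2)))).
    have := ler_wpM2r (mulr_ge0 (sqr_ge0 u) (sqr_ge0 v)) IH; lra.
  have := sqr_ge0 (A * v ^+ 2 - B * u ^+ 2); lra.
apply: (@le_trans _ _ ((u * v + Normc.normc z) ^+ 2)).
  rewrite ler_pXn2r ?nnegrE ?normc_ge0 ?addr_ge0 ?mulr_ge0//.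
  by apply: le_trans (normc_triangle _ _) _; rewrite Normc.normcM nG.
rewrite (_ : (u * v + Normc.normc z) ^+ 2 = u ^+ 2 * v ^+ 2 +
  2 * (Normc.normc z * (u * v)) + sqn z); last by ring.
lra.
Qed.
End SquaredModulus.

Section Expi.
Context {R : realType}.
Implicit Types s t : R.

Lemma expiD s t : expi (s + t) = expi s * expi t.
Proof.
rewrite /expi cosD sinD; apply/eqP.
by rewrite eq_complex /=; apply/andP; split; apply/eqP; ring.
Qed.

Lemma conj_expi t : (expi t)^* = expi (- t).
Proof. by rewrite -[LHS]/(conjc _) /expi cosN sinN. Qed.

Lemma sqn_expi t : sqn (expi t) = 1.
Proof. by rewrite sqnE /= cos2Dsin2. Qed.

End Expi.

(** * Unordered sums along finite subsets *)

Section UnorderedSums.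
Context {R : realType} {I : choiceType}.
Implicit Types (u v : I -> R) (A B : {fset I}).

Lemma partial_sumE (V : zmodType) (x : I -> V) A :
  partial_sum x A = \sum_(i <- A) x i.
Proof. by rewrite (big_seq_fsetE _ _ xpredT x). Qed.

Lemma partial_sum_ge0 u A : (forall i, 0 <= u i) -> 0 <= partial_sum u A.
Proof. by move=> u0; apply: sumr_ge0. Qed.

Lemma le_partial_sum u A B : (forall i, 0 <= u i) -> (A `<=` B)%fset ->
  partial_sum u A <= partial_sum u B.
Proof.
move=> u0 AB; rewrite !partial_sumE (big_fsetID _ (fun i => i \in A) B) /=.
rewrite (_ : [fset x in B | x \in A]%fset = A).
  by rewrite lerDl sumr_ge0.
apply/fsetP => i; rewrite !inE /=; apply/andP/idP => [[]//|iA].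
by split=> //; exact: (fsubsetP AB).
Qed.

Lemma partial_sum_le_esum u A : (forall i, 0 <= u i) ->
  ((partial_sum u A)%:E <= \esum_(i in [set: I]) (u i)%:E)%E.
Proof.
move=> u0; apply: esum_ge; exists [set` A]; first by split.
by rewrite fsbig_finite//= set_fsetK partial_sumE sumEFin.
Qed.

Lemma esum_le_partial_sum u (M : \bar R) :
  (forall A, ((partial_sum u A)%:E <= M)%E) ->
  (\esum_(i in [set: I]) (u i)%:E <= M)%E.
Proof.
move=> uM; apply: ge_ereal_sup => _ [X [finX _] <-].
by rewrite fsbig_finite//= sumEFin -partial_sumE.
Qed.

Lemma near_totally A (P : set {fset I}) :
  (forall B, (A `<=` B)%fset -> P B) -> \forall B \near totally, P B.
Proof. by move=> AP; exists A. Qed.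

Lemma cvg_partial_sum_ge0 u : (forall i, 0 <= u i) ->
  (\esum_(i in [set: I]) (u i)%:E < +oo)%E ->
  partial_sum u A @[A --> totally] --> fine (\esum_(i in [set: I]) (u i)%:E)%E.
Proof.
move=> u0 uoo; set s := (\esum_(i in _) _)%E.
have s0 : (0 <= s)%E by apply: esum_ge0 => i _; rewrite lee_fin.
have sE : (fine s)%:E = s by rewrite fineK// ge0_fin_numE.
apply/cvgrPdist_lt => e e0.
have [A hA] : exists A, fine s - e < partial_sum u A.
  apply: contrapT => /forallNP nA.
  have : (s <= (fine s - e)%:E)%E.
    by apply: esum_le_partial_sum => A; rewrite lee_fin leNgt; apply/negP/nA.
  by rewrite -[X in (X <= _)%E]sE lee_fin lerDl oppr_ge0 leNgt e0.
apply: (near_totally (A := A)) => B AB.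
have Bs : partial_sum u B <= fine s by rewrite -lee_fin sE partial_sum_le_esum.
rewrite ger0_norm ?subr_ge0// ltrBlDl -ltrBlDr.
exact: lt_le_trans hA (le_partial_sum u0 AB).
Qed.

(** [u] is the difference of the nonnegative families [|u| + u] and [|u|],
    both with bounded partial sums. *)
Lemma cvg_partial_sum_abs u (M : R) : (forall A, partial_sum (fun i => `|u i|) A <= M) ->
  cvg (partial_sum u A @[A --> totally]).
Proof.
move=> uM.
pose p i := `|u i| + u i; pose q i := `|u i|.
have q0 i : 0 <= q i by exact: normr_ge0.
have p0 i : 0 <= p i by rewrite /p -lerBlDr sub0r -normrN ler_norm.
have pq i : p i <= q i *+ 2 by rewrite /p /q mulr2n lerD2l ler_norm.
have fin_q : (\esum_(i in [set: I]) (q i)%:E < +oo)%E.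
  by apply: le_lt_trans (ltry M); apply: esum_le_partial_sum => A; rewrite lee_fin.
have fin_p : (\esum_(i in [set: I]) (p i)%:E < +oo)%E.
  apply: le_lt_trans (ltry (M *+ 2)); apply: esum_le_partial_sum => A; rewrite lee_fin.
  apply: (@le_trans _ _ (partial_sum (fun i => q i *+ 2) A)); first exact: ler_sum.
  by rewrite /partial_sum sumrMnl lerMn2r uM orbT.
apply/cvg_ex; eexists.
rewrite (_ : partial_sum u = partial_sum p \- partial_sum q).
  exact: cvgB (cvg_partial_sum_ge0 p0 fin_p) (cvg_partial_sum_ge0 q0 fin_q).
apply/funext => A /=; rewrite /partial_sum -sumrB.
by apply: eq_bigr => i _; rewrite /p /q; ring.
Qed.

(** The topology on [R[i]^o] is that of the modulus, whose values are
    themselves complex numbers; this reduces it to the two coordinates. *)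
Lemma cvg_complexP T (F : set_system T) (FF : Filter F) (x : T -> R[i]) (l : R[i]) :
  complex.Re (x t) @[t --> F] --> complex.Re l ->
  complex.Im (x t) @[t --> F] --> complex.Im l ->
  (x : T -> R[i]^o) t @[t --> F] --> (l : R[i]^o).
Proof.
move=> /cvgrPdist_lt hRe /cvgrPdist_lt hIm.
apply/cvgrPdist_lt => e; rewrite ltcE /= => /andP[/eqP Ime e0].
have e2 : 0 < complex.Re e / 2 by rewrite divr_gt0.
near=> t.
have h1 : `|complex.Re l - complex.Re (x t)| < complex.Re e / 2 by near: t; exact: hRe.
have h2 : `|complex.Im l - complex.Im (x t)| < complex.Re e / 2 by near: t; exact: hIm.
rewrite normc_def ltcE /= Ime eqxx /=.
rewrite -(@ltr_pXn2r _ 2)// ?nnegrE ?sqrtr_ge0 ?ltW//.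
rewrite sqr_sqrtr ?addr_ge0 ?sqr_ge0//.
have sq (a b : R) : `|a| < b -> a ^+ 2 < b ^+ 2.
  move=> ab; rewrite -[a ^+ 2]real_normK ?num_real//.
  by rewrite ltr_pXn2r ?nnegrE// (le_trans _ (ltW ab)).
have := sq _ _ h1; have := sq _ _ h2.
have -> : complex.Re (l - x t) = complex.Re l - complex.Re (x t).
  by rewrite raddfB.
have -> : complex.Im (l - x t) = complex.Im l - complex.Im (x t).
  by rewrite raddfB.
have := mulr_gt0 e2 e2; lra.
Unshelve. all: by end_near. Qed.

(** Both coordinates are dominated by the modulus, so the real case applies to
    each of them. *)
Lemma cvg_partial_sum_complex (z : I -> R[i]) (M : R) :
  (forall A, partial_sum (fun i => Normc.normc (z i)) A <= M) ->
  partial_sum (z : I -> R[i]^o) A @[A --> totally] --> (sum (z : I -> R[i]^o)).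
Proof.
move=> zM.
have Re_le (a : R[i]) : `|complex.Re a| <= Normc.normc a.
  rewrite -(@ler_pXn2r _ 2)// ?nnegrE ?normc_ge0// sqnE real_normK ?num_real//.
  by rewrite lerDl sqr_ge0.
have Im_le (a : R[i]) : `|complex.Im a| <= Normc.normc a.
  rewrite -(@ler_pXn2r _ 2)// ?nnegrE ?normc_ge0// sqnE real_normK ?num_real//.
  by rewrite lerDr sqr_ge0.
have /cvg_ex[a ha] : cvg (partial_sum (fun i => complex.Re (z i)) A @[A --> totally]).
  apply: (@cvg_partial_sum_abs _ M) => A; apply: le_trans (zM A).
  by apply: ler_sum => i _; exact: Re_le.
have /cvg_ex[b hb] : cvg (partial_sum (fun i => complex.Im (z i)) A @[A --> totally]).
  apply: (@cvg_partial_sum_abs _ M) => A; apply: le_trans (zM A).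
  by apply: ler_sum => i _; exact: Im_le.
have H : partial_sum (z : I -> R[i]^o) A @[A --> totally] --> ((a +i* b)%C : R[i]^o).
  apply: cvg_complexP => /=.
    by under eq_fun do rewrite /partial_sum Re_sum; exact: ha.
  by under eq_fun do rewrite /partial_sum Im_sum; exact: hb.
apply: (cvgP _ H).
Qed.

Lemma sum_unique (z : I -> R[i]) (l : R[i]) :
  partial_sum (z : I -> R[i]^o) A @[A --> totally] --> (l : R[i]^o) ->
  sum (z : I -> R[i]^o) = l.
Proof. by move=> H; apply: cvg_lim H; exact: norm_hausdorff. Qed.

End UnorderedSums.

(** * The inner product of square-summable matrix sequences *)

Section MatrixSquares.
Context {R : realType} {n : nat}.
Implicit Types a b : 'M[R[i]]_n.

Definition mxsqn a : R := \sum_(m < n) \sum_(k < n) sqn (a m k).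

Definition mxdot a b : R[i] := \sum_(m < n) \sum_(k < n) a m k * (b m k)^*.

Lemma mxsqn_ge0 a : 0 <= mxsqn a.
Proof. by apply: sumr_ge0 => m _; apply: sumr_ge0 => k _; exact: sqn_ge0. Qed.

Lemma sqr_mxnorm a : mxnorm a ^+ 2 = mxsqn a.
Proof. by rewrite sqr_sqrtr// mxsqn_ge0. Qed.

Lemma mxdot_self a : mxdot a a = (mxsqn a)%:C%C.
Proof.
rewrite /mxsqn rmorph_sum; apply: eq_bigr => m _.
by rewrite rmorph_sum; apply: eq_bigr => k _; exact: mul_conjE.
Qed.

Lemma mxdot_sumr (I : Type) (s : seq I) a (c : I -> R[i]) (b : I -> 'M[R[i]]_n) :
  mxdot a (\sum_(i <- s) c i *: b i) = \sum_(i <- s) (c i)^* * mxdot a (b i).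
Proof.
rewrite /mxdot; under [RHS]eq_bigr => i _ do rewrite mulr_sumr.
rewrite [RHS]exchange_big; apply: eq_bigr => m _ /=.
under [RHS]eq_bigr => i _ do rewrite mulr_sumr.
rewrite [RHS]exchange_big; apply: eq_bigr => k _ /=.
rewrite summxE. rewrite conjc_sum mulr_sumr; apply: eq_bigr => i _.
by rewrite mxE rmorphM /= mulrCA.
Qed.

Lemma sqn_sum_mxdot_CS (I : finType) (a b : I -> 'M[R[i]]_n) :
  sqn (\sum_i mxdot (a i) (b i)) <= (\sum_i mxsqn (a i)) * (\sum_i mxsqn (b i)).
Proof.
rewrite /mxdot /mxsqn.
under eq_bigr => i _ do rewrite pair_bigA.
under [in leRHS]eq_bigr => i _ do rewrite pair_bigA.
under [X in _ <= _ * X]eq_bigr => i _ do rewrite pair_bigA.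
by rewrite !pair_bigA /=; exact: sqn_sum_CS.
Qed.

(** This domination makes the series that defines [ell2_inner] converge
    absolutely on square-summable sequences. *)
Lemma normc_mxdot_le a b : Normc.normc (mxdot a b) <= mxsqn a + mxsqn b.
Proof.
have := @sqn_sum_mxdot_CS 'I_1 (fun=> a) (fun=> b); rewrite !big_ord1 => CS.
have a0 := mxsqn_ge0 a; have b0 := mxsqn_ge0 b.
rewrite -(@ler_pXn2r _ 2)// ?nnegrE ?normc_ge0 ?addr_ge0//.
apply: le_trans CS _; have := mulr_ge0 a0 b0.
have := sqr_ge0 (mxsqn a); have := sqr_ge0 (mxsqn b); lra.
Qed.

End MatrixSquares.

Section InnerProduct.
Context {R : realType} {n N r : nat}.
Implicit Types f g h : Lambda R N r -> 'M[R[i]]_n.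

Lemma cvg_complex_dist T (F : set_system T) (FF : Filter F) (z : T -> R[i]) (l : R[i]) :
  (z : T -> R[i]^o) t @[t --> F] --> (l : R[i]^o) ->
  forall e : R, 0 < e -> \forall t \near F, Normc.normc (l - z t) < e.
Proof.
move=> /cvgrPdist_lt H e e0.
have /H : 0 < e%:C%C by rewrite ltcR.
by apply: (@filterS _ _ FF) => t; rewrite normc_def ltcR; case: (l - z t).
Qed.

Lemma cvg_normc_le T (F : set_system T) (FF : ProperFilter F) (z : T -> R[i])
    (l : R[i]) (K : R) :
  (z : T -> R[i]^o) t @[t --> F] --> (l : R[i]^o) ->
  (forall t, Normc.normc (z t) <= K) -> Normc.normc l <= K.
Proof.
move=> /cvg_complex_dist H zK; apply/ler_addgt0Pr => e e0.
have [t zt] := filter_ex (H e e0).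
rewrite -(subrK (z t) l) addrC [K + e]addrC.
rewrite addrC; apply: le_trans (normc_triangle _ _) _.
by rewrite lerD// ltW.
Qed.

Lemma partial_sum_mxsqn_le f (A : {fset Lambda R N r}) : ell2 f ->
  partial_sum (fun l => mxsqn (f l)) A <=
  fine (\esum_(l in [set: Lambda R N r]) (mxsqn (f l))%:E)%E.
Proof.
move=> f2; rewrite -lee_fin fineK.
  by apply: partial_sum_le_esum => l; exact: mxsqn_ge0.
by rewrite ge0_fin_numE// esum_ge0// => l _; rewrite lee_fin mxsqn_ge0.
Qed.

Lemma cvg_ell2_inner g h : ell2 g -> ell2 h ->
  partial_sum (fun l => mxdot (g l) (h l) : R[i]^o) A @[A --> totally]
    --> (ell2_inner g h : R[i]^o).
Proof.
move=> g2 h2.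
pose total f := fine (\esum_(l in [set: Lambda R N r]) (mxsqn (f l))%:E)%E.
apply: (@cvg_partial_sum_complex _ _ (fun l => mxdot (g l) (h l))
  (total g + total h)) => A.
apply: le_trans (lerD (partial_sum_mxsqn_le A g2) (partial_sum_mxsqn_le A h2)).
rewrite /partial_sum -big_split /=.
by apply: ler_sum => l _; exact: normc_mxdot_le.
Qed.

Lemma ell2_inner_self f : ell2 f -> ell2_inner f f =
  (fine (\esum_(l in [set: Lambda R N r]) (mxsqn (f l))%:E)%E)%:C%C.
Proof.
move=> f2; apply: sum_unique.
apply: (@cvg_complexP _ _ totally _ (partial_sum (fun l => mxdot (f l) (f l)))).
  rewrite (_ : (fun A => _) = partial_sum (fun l => mxsqn (f l))).
    by apply: cvg_partial_sum_ge0 => // l; exact: mxsqn_ge0.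
  apply/funext => A; rewrite /partial_sum Re_sum.
  by apply: eq_bigr => l _; rewrite mxdot_self.
rewrite (_ : (fun A => _) = cst 0); first exact: cvg_cst.
apply/funext => A; rewrite /partial_sum Im_sum.
by apply: big1 => l _; rewrite mxdot_self.
Qed.

Lemma sqr_ell2_norm f : ell2 f ->
  (ell2_norm f ^+ 2)%:E = (\esum_(l in [set: Lambda R N r]) (mxsqn (f l))%:E)%E.
Proof.
move=> f2; have s0 : (0 <= \esum_(l in [set: Lambda R N r]) (mxsqn (f l))%:E)%E.
  by apply: esum_ge0 => l _; rewrite lee_fin mxsqn_ge0.
rewrite /ell2_norm ell2_inner_self//= sqr_sqrtr ?fine_ge0//.
by rewrite fineK// ge0_fin_numE.
Qed.

Lemma ell2_inner_selfE f : ell2 f -> ell2_inner f f = (ell2_norm f ^+ 2)%:C%C.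
Proof. by move=> f2; rewrite ell2_inner_self// -sqr_ell2_norm. Qed.

Lemma ell2_inner_CS g h : ell2 g -> ell2 h ->
  sqn (ell2_inner g h) <= ell2_norm g ^+ 2 * ell2_norm h ^+ 2.
Proof.
move=> g2 h2.
have norm_ge0 f : 0 <= ell2_norm f by exact: sqrtr_ge0.
rewrite -exprMn ler_pXn2r ?nnegrE ?normc_ge0 ?mulr_ge0//.
apply: cvg_normc_le (cvg_ell2_inner g2 h2) _ => A.
rewrite -(@ler_pXn2r _ 2)// ?nnegrE ?normc_ge0 ?mulr_ge0// exprMn.
apply: le_trans (sqn_sum_mxdot_CS _ _) _.
apply: ler_pM; try by apply: sumr_ge0 => l _; exact: mxsqn_ge0.
  by rewrite -lee_fin sqr_ell2_norm//; apply: partial_sum_le_esum => l; exact: mxsqn_ge0.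
by rewrite -lee_fin sqr_ell2_norm//; apply: partial_sum_le_esum => l; exact: mxsqn_ge0.
Qed.

Lemma ell2_inner_sumr (I : Type) (s : seq I) g (c : I -> R[i])
    (h : I -> Lambda R N r -> 'M[R[i]]_n) :
  ell2 g -> (forall i, ell2 (h i)) ->
  ell2_inner g (fun l => \sum_(i <- s) c i *: h i l) =
  \sum_(i <- s) (c i)^* * ell2_inner g (h i).
Proof.
move=> g2 h2; apply: sum_unique.
rewrite (_ : partial_sum _ =
    fun A => \sum_(i <- s) (c i)^* * partial_sum (fun l => mxdot (g l) (h i l)) A).
  elim: s => [|i s IH].
    rewrite big_nil (_ : (fun A => _) = cst 0); first exact: cvg_cst.
    by apply/funext => A; rewrite big_nil.
  rewrite big_cons (_ : (fun A => _) =
      ((fun A => (c i)^* * partial_sum (fun l => mxdot (g l) (h i l)) A) \+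
       (fun A => \sum_(j <- s) (c j)^* *
                 partial_sum (fun l => mxdot (g l) (h j l)) A))); last first.
    by apply/funext => A; rewrite big_cons.
  have Z : (c i)^* * partial_sum (fun l => mxdot (g l) (h i l) : R[i]^o) A
      @[A --> totally] --> ((c i)^* * ell2_inner g (h i) : R[i]^o).
    exact: cvgZl_tmp (cvg_ell2_inner g2 (h2 i)).
  exact: cvgD Z IH.
apply/funext => A.
under [RHS]eq_bigr => i _ do rewrite mulr_sumr.
rewrite [RHS]exchange_big; apply: eq_bigr => l _ /=.
exact: mxdot_sumr.
Qed.

End InnerProduct.

(** * Limits of complex functions in the square mean *)

Section SquareMean.
Context d (T : measurableType d) (R : realType).
Variables (mu : {measure set T -> \bar R}) (D : set T).
Hypothesis mD : measurable D.
Implicit Types (F G : T -> R[i]).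

Definition cmeas F : Prop :=
  measurable_fun D (fun x => complex.Re (F x)) /\
  measurable_fun D (fun x => complex.Im (F x)).

Definition L2sq F : \bar R := (\int[mu]_(x in D) (sqn (F x))%:E)%E.

Lemma cmeas_cst (c : R[i]) : cmeas (cst c).
Proof. by split; exact: measurable_cst. Qed.

Lemma cmeasD F G : cmeas F -> cmeas G -> cmeas (fun x => F x + G x).
Proof.
move=> [rF iF] [rG iG]; split.
  under eq_fun do rewrite raddfD; exact: measurable_funD.
under eq_fun do rewrite raddfD; exact: measurable_funD.
Qed.

Lemma cmeasB F G : cmeas F -> cmeas G -> cmeas (fun x => F x - G x).
Proof.
move=> [rF iF] [rG iG]; split.
  under eq_fun do rewrite raddfB; exact: measurable_funB.
under eq_fun do rewrite raddfB; exact: measurable_funB.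
Qed.

Lemma cmeasM F G : cmeas F -> cmeas G -> cmeas (fun x => F x * G x).
Proof.
have ReM (a b : R[i]) : complex.Re (a * b) =
  complex.Re a * complex.Re b - complex.Im a * complex.Im b by case: a b => [? ?] [].
have ImM (a b : R[i]) : complex.Im (a * b) =
  complex.Re a * complex.Im b + complex.Im a * complex.Re b.
  by case: a b => [? ?] [? ?] /=.
move=> [rF iF] [rG iG]; split.
  by under eq_fun do rewrite ReM; apply: measurable_funB; exact: measurable_funM.
by under eq_fun do rewrite ImM; apply: measurable_funD; exact: measurable_funM.
Qed.

Lemma cmeas_sum (I : Type) (s : seq I) (F : I -> T -> R[i]) :
  (forall i, cmeas (F i)) -> cmeas (fun x => \sum_(i <- s) F i x).
Proof.
move=> mF; elim: s => [|i s IH].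
  by under eq_fun do rewrite big_nil; exact: (cmeas_cst 0).
by under eq_fun do rewrite big_cons; exact: cmeasD.
Qed.

Lemma measurable_sqn F : cmeas F -> measurable_fun D (fun x => sqn (F x)).
Proof.
move=> [rF iF]; under eq_fun do rewrite sqnE.
by apply: measurable_funD; exact: measurable_funX.
Qed.

Lemma measurable_EFin_sqn F : cmeas F -> measurable_fun D (fun x => (sqn (F x))%:E).
Proof. by move=> mF; apply/measurable_EFinP; exact: measurable_sqn. Qed.

Lemma L2sq_ge0 F : (0 <= L2sq F)%E.
Proof. by apply: integral_ge0 => x _; rewrite lee_fin sqn_ge0. Qed.

Lemma L2sqD_le e F G : 0 < e -> cmeas F -> cmeas G ->
  (L2sq (fun x => F x + G x)%R <=
   (1 + e)%:E * L2sq F + (1 + e^-1)%:E * L2sq G)%E.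
Proof.
move=> e0 mF mG.
have e1 : (0 <= 1 + e)%R by lra.
have e2 : (0 <= 1 + e^-1)%R by rewrite addr_ge0// invr_ge0 ltW.
have [mF2 mG2] := (measurable_EFin_sqn mF, measurable_EFin_sqn mG).
rewrite -!ge0_integralZl_EFin//; try by move=> x _; rewrite lee_fin sqn_ge0.
rewrite -ge0_integralD//; first last.
- exact: emeasurable_funM.
- by move=> x _; rewrite -EFinM lee_fin mulr_ge0 ?sqn_ge0.
- exact: emeasurable_funM.
- by move=> x _; rewrite -EFinM lee_fin mulr_ge0 ?sqn_ge0.
apply: ge0_le_integral => //.
- by move=> x _; rewrite lee_fin sqn_ge0.
- by apply: measurable_EFin_sqn; exact: cmeasD.
- by apply: emeasurable_funD; exact: emeasurable_funM.
- by move=> x _; rewrite -!EFinM -EFinD lee_fin sqnD_le.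
Qed.

Lemma limn_einf_le (u : nat -> \bar R) (M : \bar R) :
  (forall k, (u k <= M)%E) -> (limn_einf u <= M)%E.
Proof.
move=> uM; rewrite limn_einf_lim; apply: lime_le; first exact: is_cvg_einfs.
apply: nearW => k; apply: le_trans (uM k).
by apply: ereal_inf_lbound; exists k => /=.
Qed.

Lemma cvg_geometric_steps (u : nat -> R) (C : R) :
  (forall k, `|u k.+1 - u k| <= C * 2^-1 ^+ k) -> cvg (u k @[k --> \oo]).
Proof.
move=> uC.
have C0 : 0 <= C by have := uC 0%N; rewrite expr0 mulr1; apply: le_trans.
have : cvgn (series (telescope u)).
  apply: normed_cvg; apply: (@series_le_cvg _ _ (geometric C 2^-1)) => //.
  - by move=> k; exact: normr_ge0.
  - by move=> k; rewrite /= mulr_ge0// exprn_ge0// invr_ge0.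
  - by apply: is_cvg_geometric_series; rewrite ger0_norm ?invr_ge0// invf_lt1// ltr1n.
rewrite telescopeK => /cvg_ex[l ul].
apply/cvg_ex; exists (l + u 0%N).
suff -> : [eta u] = (fun k => [sequence u n - u 0%N]_n k + u 0%N).
  exact: cvgD ul (cvg_cst _).
by apply/funext => k /=; rewrite subrK.
Qed.

(** The limit is expressed by an upper limit, which makes sense, and is
    measurable in a parameter, even where the sequence diverges. *)
Lemma cvg_geometric_steps_esup (u : nat -> R) (C : R) :
  (forall k, `|u k.+1 - u k| <= C * 2^-1 ^+ k) ->
  u k @[k --> \oo] --> fine (limn_esup (fun k => (u k)%:E)).
Proof.
move=> /cvg_geometric_steps/cvg_ex[l ul].
have ulE : (u k)%:E @[k --> \oo] --> l%:E by apply: cvg_EFin => //; exact: nearW.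
by rewrite (cvg_limn_einf_sup ulE).2.
Qed.

(** Riesz-Fischer. The weighted series [sum 4^k |S (k+1) - S k|^2] has finite
    integral, so it is finite almost everywhere, which bounds the steps by a
    geometric sequence there. The limit is given as an upper limit so that it
    is measurable without removing the exceptional set; Fatou's lemma then
    turns pointwise into square-mean convergence. The conclusion measures the
    distance of [F] to an arbitrary [G], which covers limits along directed sets
    of which [S] is only a subsequence. *)
Lemma riesz_fischer (S : nat -> T -> R[i]) :
  (forall k, cmeas (S k)) ->
  (forall k, (L2sq (fun x => S k.+1 x - S k x)%R <= (8^-1 ^+ k)%:E)%E) ->
  exists F, cmeas F /\ forall G k0 (M : \bar R), cmeas G ->
    (forall k, (k0 <= k)%N -> (L2sq (fun x => G x - S k x)%R <= M)%E) ->
    (L2sq (fun x => G x - F x)%R <= M)%E.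
Proof.
move=> mS dS.
pose w k x := 4 ^+ k * sqn (S k.+1 x - S k x).
have w0 k x : 0 <= w k x by rewrite mulr_ge0// ?sqn_ge0// exprn_ge0.
have mw k : measurable_fun D (fun x => (w k x)%:E).
  apply/measurable_EFinP; apply: measurable_funM => //.
  by apply: measurable_sqn; exact: cmeasB.
(* 4^k 8^-k = 2^-k, in the shape of the terms of a geometric series of sum 2. *)
have int_w k : (\int[mu]_(x in D) (w k x)%:E <= (2 / (2 ^ (k + 1))%:R)%:E)%E.
  under eq_integral do rewrite /w EFinM.
  have mdS := measurable_EFin_sqn (cmeasB (mS k.+1) (mS k)).
  rewrite ge0_integralZl_EFin ?exprn_ge0//; last first.
    by move=> x _; rewrite lee_fin sqn_ge0.
  apply: le_trans (lee_wpmul2l _ (dS k)) _.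
    by rewrite lee_fin exprn_ge0.
  rewrite -EFinM lee_fin -exprMn natrX addn1 exprS invfM mulrA divff// mul1r.
  by rewrite (_ : 4 / 8 = 2^-1 :> R) ?exprVn//; lra.
have mW : measurable_fun D (fun x => \sum_(0 <= k <oo) (w k x)%:E)%E.
  apply: (@ge0_emeasurable_sum _ _ _ D (fun k x => (w k x)%:E) xpredT) => //.
  by move=> k x _ _; rewrite lee_fin.
have W0 x : (0 <= \sum_(0 <= k <oo) (w k x)%:E)%E.
  by apply: nneseries_ge0 => k _ _; rewrite lee_fin.
have intW : mu.-integrable D (fun x => \sum_(0 <= k <oo) (w k x)%:E)%E.
  apply/integrableP; split => //.
  under eq_integral do rewrite gee0_abs//.
  rewrite integral_nneseries//; last by move=> k x _; rewrite lee_fin.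
  apply: (@le_lt_trans _ _ (\sum_(0 <= k <oo) (2 / (2 ^ (k + 1))%:R)%:E)%E).
    apply: lee_nneseries => k *; last exact: int_w.
    by apply: integral_ge0 => x _; rewrite lee_fin.
  rewrite (@cvg_lim _ _ _ _ _ _ _ (@cvg_geometric_eseries_half R 2 0))//.
  exact: ltry.
have aeW := integrable_ae mD intW.
pose re k x := complex.Re (S k x); pose im k x := complex.Im (S k x).
pose F x : R[i] := (fine (limn_esup (fun k => (re k x)%:E)) +i*
                    fine (limn_esup (fun k => (im k x)%:E)))%C.
have mF : cmeas F.
  split.
    apply: (@measurableT_comp _ _ _ _ _ _ fine); first exact: fine_measurable.
    by apply: measurable_fun_limn_esup => k; apply/measurable_EFinP; exact: (mS k).1.
  apply: (@measurableT_comp _ _ _ _ _ _ fine); first exact: fine_measurable.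
  by apply: measurable_fun_limn_esup => k; apply/measurable_EFinP; exact: (mS k).2.
have good x : (\sum_(0 <= k <oo) (w k x)%:E)%E \is a fin_num ->
    re k x @[k --> \oo] --> complex.Re (F x) /\
    im k x @[k --> \oo] --> complex.Im (F x).
  move=> finW; set W := (\sum_(0 <= k <oo) (w k x)%:E)%E in finW.
  have wW k : w k x <= fine W.
    rewrite -lee_fin fineK//.
    have := @nneseries_lim_ge R (fun k => (w k x)%:E) xpredT 0 k.+1.
    rewrite big_nat_recr//= => H; apply: le_trans (H _) => [|j _ _].
      by rewrite leeDr// sume_ge0// => j _; rewrite lee_fin.
    by rewrite lee_fin.
  have step k (a : R) : a ^+ 2 <= sqn (S k.+1 x - S k x) ->
      `|a| <= Num.sqrt (fine W) * 2^-1 ^+ k.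
    move=> aS; have W_ge0 : 0 <= fine W := le_trans (w0 0%N x) (wW 0%N).
    rewrite -(@ler_pXn2r _ 2)// ?nnegrE ?mulr_ge0 ?sqrtr_ge0 ?exprn_ge0 ?invr_ge0//.
    rewrite real_normK ?num_real// exprMn sqr_sqrtr//.
    rewrite -exprM mulnC exprM exprVn -natrX exprVn ler_pdivlMr ?exprn_gt0//.
    by rewrite mulrC; apply: le_trans (wW k); rewrite ler_wpM2l ?exprn_ge0.
  split.
    apply: (@cvg_geometric_steps_esup _ (Num.sqrt (fine W))) => k; apply: step.
    by rewrite sqnE -raddfB lerDl sqr_ge0.
  apply: (@cvg_geometric_steps_esup _ (Num.sqrt (fine W))) => k; apply: step.
  by rewrite sqnE -raddfB lerDr sqr_ge0.
exists F; split=> // G k0 M mG GM.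
pose f k x := (sqn (G x - S (k + k0)%N x))%:E.
have f0 k x : (0 <= f k x)%E by rewrite lee_fin sqn_ge0.
have mf k : measurable_fun D (f k) by apply: measurable_EFin_sqn; exact: cmeasB.
apply: (@le_trans _ _ (\int[mu]_(x in D) limn_einf (f^~ x))%E); last first.
  apply: le_trans (fatou mu mD mf (fun k x _ => f0 k x)) _.
  by apply: limn_einf_le => k; apply: GM; exact: leq_addl.
apply: ae_ge0_le_integral => //.
- by move=> x _; rewrite lee_fin sqn_ge0.
- by apply: measurable_EFin_sqn; exact: cmeasB.
- move=> x _; rewrite limn_einf_lim; apply: lime_ge; first exact: is_cvg_einfs.
  by apply: nearW => k; apply: le_ereal_inf_tmp => _ [j _ <-].
- apply: (@measurableT_comp _ _ _ _ _ _ -%E) => //.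
  by apply: measurable_fun_limn_esup => k; exact: measurableT_comp.
apply: filterS aeW => x + Dx => /(_ Dx) /good[rex imx].
suff H : f k x @[k --> \oo] --> (sqn (G x - F x))%:E by rewrite (cvg_limn_einf_sup H).1.
apply: cvg_EFin; first exact: nearW.
have shift (v : nat -> R) l : v k @[k --> \oo] --> l -> v (k + k0)%N @[k --> \oo] --> l.
  by move=> vl; rewrite cvg_shiftn.
rewrite (_ : fine \o _ = fun k => (complex.Re (G x) - re (k + k0)%N x) ^+ 2 +
                                  (complex.Im (G x) - im (k + k0)%N x) ^+ 2); last first.
  by apply/funext => k; rewrite /f [LHS]sqnE !raddfB.
rewrite sqnE !raddfB.
have shB (a l : R) (v : nat -> R) : v k @[k --> \oo] --> l ->
    (a - v (k + k0)%N) ^+ 2 @[k --> \oo] --> (a - l) ^+ 2.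
  move=> /shift vl; have avl := cvgB (cvg_cst a) vl.
  by rewrite expr2; under eq_fun do rewrite expr2; apply: cvgM; exact: avl.
exact: cvgD (shB _ _ _ rex) (shB _ _ _ imx).
Qed.

End SquareMean.

(** * Orthonormal exponentials on [Omega] *)

Lemma is_derive_dilate (R : realType) (g dg : R -> R) (w x : R) : w != 0 ->
  (forall y, is_derive y (1:R) g (dg y)) ->
  is_derive x (1:R) (fun y => w^-1 * g (w * y)) (dg (w * x)).
Proof.
move=> w0 dG.
have dlin : is_derive x (1:R) ( *%R w) w.
  have := @is_deriveZ _ _ _ id w x 1 1 (is_derive_id x (1 : R)).
  by rewrite /GRing.scale /= mulr1.
have := is_derive1_comp (dG (w * x)) dlin => dc.
have := @is_deriveZ _ _ _ _ w^-1 x 1 _ dc.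
rewrite /GRing.scale /=.
rewrite (_ : w^-1 * _ = dg (w * x)) //; last by field.
Qed.

Section OmegaIntegrals.
Context {R : realType} (N : nat).
Hypothesis N_gt0 : (0 < N)%N.
Local Notation leb := (@lebesgue_measure R).
Implicit Types (f F : R -> R) (w mu x : R).

Lemma measurable_Omega : measurable (Omega R N : set (measurableTypeR R)).
Proof. by apply: measurableU; exact: measurable_itv. Qed.

Lemma integrable_continuous_Omega f : continuous f ->
  leb.-integrable (Omega R N) (EFin \o f).
Proof.
move=> cf.
have intK : leb.-integrable `[0, (N%:R + 1) / 2] (EFin \o f).
  apply: continuous_compact_integrable; first exact: segment_compact.
  exact: continuous_subspaceT.
apply: integrableS intK => //; first exact: measurable_Omega.
have N0 : 0 <= N%:R :> R by [].
by move=> x [] /=; rewrite !in_itv /= => /andP[x0 x1]; apply/andP; split; lra.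
Qed.

Lemma integral_derive_itvco f F (a b : R) : a < b -> continuous f ->
  (forall x, is_derive x 1 F (f x)) ->
  (\int[leb]_(x in `[a, b[) (f x)%:E = (F b - F a)%:E)%E.
Proof.
move=> ab cf dF.
have cF : continuous F.
  by move=> x; apply: differentiable_continuous; apply/derivable1_diffP; by case: (dF x).
rewrite integral_itv_bndo_bndc; last first.
  by apply/measurable_EFinP/measurable_funTS; exact: continuous_measurable_fun.
rewrite (@continuous_FTC2 _ f F)//.
- exact: continuous_subspaceT.
- split.
  + by move=> x _; by case: (dF x).
  + by apply: cvg_at_right_filter; exact: cF.
  + by apply: cvg_at_left_filter; exact: cF.
- by move=> x _; rewrite derive1E; by case: (dF x).
Qed.

(** [Omega] consists of two translates of [`[0, 1/2[] at distance [N/2]: an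
    integral over it cancels when the antiderivative repeats after [1/2], or
    changes sign after [N/2]. *)
Lemma integral_Omega_cancel f F : continuous f ->
  (forall x, is_derive x 1 F (f x)) ->
  (forall x, F (x + 1 / 2) = F x) \/ (forall x, F (x + N%:R / 2) = - F x) ->
  (\int[leb]_(x in Omega R N) (f x)%:E = 0)%E.
Proof.
move=> cf dF FP.
have N1 : 1 <= N%:R :> R by rewrite (ler_nat R 1 N).
have mf : measurable_fun (Omega R N) (fun x => (f x)%:E).
  by apply/measurable_EFinP/measurable_funTS; exact: continuous_measurable_fun.
have dis : [disjoint `[0, 1 / 2[ : set R & `[N%:R / 2, (N%:R + 1) / 2[ : set R].
  by apply/disj_setPS => x [] /=; rewrite !in_itv /= => /andP[_ x1] /andP[x2 _]; lra.
rewrite /Omega (@integral_setU _ (measurableTypeR R) R leb _ _ _ _ _ mf dis);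
  try exact: measurable_itv.
rewrite (integral_derive_itvco _ cf dF); last by lra.
rewrite (integral_derive_itvco _ cf dF); last by lra.
rewrite -EFinD; congr EFin; case: FP => FP.
  have := FP 0; have := FP (N%:R / 2); rewrite add0r -mulrDl => -> ->; ring.
have := FP 0; have := FP (1 / 2); rewrite add0r -mulrDl [1 + _]addrC => -> ->; ring.
Qed.

Lemma periodic_int f (T : R) (k : int) : periodic f T ->
  forall x, f (x + T * k%:~R) = f x.
Proof.
move=> fT x; case: k => k; first by rewrite mulr_natr periodicn.
rewrite NegzE -[in RHS](subrK (T *+ k.+1) x) periodicn//.
by rewrite rmorphN /= mulrN mulr_natr.
Qed.

Lemma alternating_odd f (T : R) (k : int) : alternating f T ->
  forall x, f (x + T * (2 * k + 1)%:~R) = - f x.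
Proof.
move=> fT x; have f2T : periodic f (T *+ 2).
  by move=> y; rewrite mulr2n addrA !fT opprK.
rewrite -[in RHS](periodic_int k f2T) -fT; congr f.
rewrite rmorphD rmorphM /=; ring.
Qed.

(** Two exponentials whose frequencies differ by such a gap are orthogonal on
    [Omega], the first kind by periodicity on each interval of [Omega], the
    second by cancellation between the two intervals. All gaps of [Lambda] are
    of these kinds. *)
Definition orthogonal_gap mu : Prop :=
  (mu != 0 /\ exists k : int, mu = 2 * k%:~R) \/
  exists k : int, N%:R * mu = (2 * k + 1)%:~R.

Lemma orthogonal_gap_neq0 mu : orthogonal_gap mu -> mu != 0.
Proof.
case=> [[]//|[k]]; apply: contra_eq_neq => ->.
rewrite mulr0 eq_sym intr_eq0; lia.
Qed.

Lemma integral_Omega_cos_sin mu : orthogonal_gap mu ->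
  (\int[leb]_(x in Omega R N) (cos (2 * pi * mu * x))%:E = 0)%E /\
  (\int[leb]_(x in Omega R N) (sin (2 * pi * mu * x))%:E = 0)%E.
Proof.
move=> gap; have mu0 := orthogonal_gap_neq0 gap.
set w := 2 * pi * mu.
have w0 : w != 0 by rewrite /w !mulf_neq0// gt_eqF// pi_gt0.
have shift (g : R -> R) : alternating g pi ->
    (forall x, g (w * (x + 1 / 2)) = g (w * x)) \/
    (forall x, g (w * (x + N%:R / 2)) = - g (w * x)).
  move=> g_alt; case: gap => [[_ [k muE]]|[k muE]]; [left|right] => x.
    have g2 : periodic g (pi *+ 2) by move=> y; rewrite mulr2n addrA !g_alt opprK.
    by rewrite -(periodic_int k g2 (w * x)); congr g; rewrite /w muE; field.
  by rewrite -(alternating_odd k g_alt) -muE; congr g; rewrite /w; field.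
have lin : continuous ( *%R w) by exact: mulrl_continuous.
split.
- apply: (@integral_Omega_cancel _ (fun x => w^-1 * sin (w * x))).
  + by move=> x; apply: continuous_comp; [exact: lin|exact: continuous_cos].
  + by move=> x; apply: is_derive_dilate => // y; exact: is_derive_sin.
  + by have [H|H] := shift sin (@sinDpi R); [left|right] => x; rewrite H// mulrN.
- apply: (@integral_Omega_cancel _ (fun x => w^-1 * - cos (w * x))).
  + by move=> x; apply: continuous_comp; [exact: lin|exact: continuous_sin].
  + move=> x; apply: (@is_derive_dilate _ (fun y => - cos y)) => // y.
    by have := is_deriveN (is_derive_cos y); rewrite opprK.
  + by have [H|H] := shift cos (@cosDpi R); [left|right] => x; rewrite H// mulrN.
Qed.

End OmegaIntegrals.

Section Orthonormality.
Context {R : realType} (N : nat).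
Hypothesis N_gt0 : (0 < N)%N.
Local Notation leb := (@lebesgue_measure R).

Lemma lebesgue_measure_Omega : leb (Omega R N) = 1%E.
Proof.
have N1 : 1 <= N%:R :> R by rewrite (ler_nat R 1 N).
have -> : leb (Omega R N) =
    (leb (`[0%R, (1 / 2)%R[)%classic + leb (`[(N%:R / 2)%R, ((N%:R + 1) / 2)%R[)%classic)%E.
  apply: measureU; try exact: measurable_itv.
  rewrite -subset0 => x [] /=; rewrite !in_itv /= => /andP[_ x1] /andP[x2 _]; lra.
rewrite !lebesgue_measure_itv /= !lte_fin.
rewrite ifT; last by lra.
rewrite ifT; last by lra.
by rewrite -!EFinB -EFinD; congr EFin; field.
Qed.

Lemma cmeas_expi (D : set R) t : cmeas D (fun x => expi (t * x)).
Proof.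
have lin : continuous ( *%R t) by exact: mulrl_continuous.
split; apply: measurable_funTS; apply: continuous_measurable_fun => x;
  (apply: continuous_comp; first exact: lin).
- exact: continuous_cos.
- exact: continuous_sin.
Qed.

Lemma sqn_trig (I : finType) (c : I -> R[i]) (phi : I -> R) x :
  sqn (\sum_i c i * expi (2 * pi * phi i * x)) =
  \sum_i \sum_j (complex.Re (c i * (c j)^*) * cos (2 * pi * (phi i - phi j) * x) -
                 complex.Im (c i * (c j)^*) * sin (2 * pi * (phi i - phi j) * x)).
Proof.
rewrite sqn_Re rmorph_sum mulr_suml Re_sum; apply: eq_bigr => i _.
rewrite mulr_sumr Re_sum; apply: eq_bigr => j _.
rewrite rmorphM /= conj_expi mulrACA -expiD -mulNr -mulrN -mulrDl -mulrDr.
by case: (c i * _).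
Qed.

Lemma L2sq_trig (I : finType) (c : I -> R[i]) (phi : I -> R) :
  (forall i j, i != j -> orthogonal_gap N (phi i - phi j)) ->
  L2sq leb (Omega R N) (fun x => \sum_i c i * expi (2 * pi * phi i * x)) =
  (\sum_i sqn (c i))%:E.
Proof.
move=> gap; rewrite /L2sq; have mO := measurable_Omega (R := R) N.
pose a i j := complex.Re (c i * (c j)^*); pose b i j := complex.Im (c i * (c j)^*).
pose t i j := 2 * pi * (phi i - phi j).
have lin w : continuous ( *%R (w : R)) by exact: mulrl_continuous.
have icos w : leb.-integrable (Omega R N) (EFin \o (fun x => cos (w * x))).
  apply: integrable_continuous_Omega => // x.
  by apply: continuous_comp; [exact: lin|exact: continuous_cos].
have isin w : leb.-integrable (Omega R N) (EFin \o (fun x => sin (w * x))).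
  apply: integrable_continuous_Omega => // x.
  by apply: continuous_comp; [exact: lin|exact: continuous_sin].
under eq_integral => x _.
  rewrite sqn_trig -sumEFin.
  under eq_bigr => i _.
    rewrite -sumEFin.
    under eq_bigr => j _ do rewrite EFinB !EFinM.
    over.
  over.
have int_term i j : leb.-integrable (Omega R N)
    (fun x => (a i j)%:E * (cos (t i j * x))%:E - (b i j)%:E * (sin (t i j * x))%:E)%E.
  apply: integrableB => //; apply: integrableZl => //; [exact: icos|exact: isin].

rewrite (@integral_sum _ (measurableTypeR R) R leb _ mO); last first.
  by move=> i; apply: integrable_sum => // j _; exact: int_term.
rewrite -sumEFin; apply: eq_bigr => i _.
rewrite (@integral_sum _ (measurableTypeR R) R leb _ mO); last first.
  by move=> j; exact: int_term.
rewrite (bigD1 i)// big1 => [|j ji].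
  rewrite [LHS]adde0.
  rewrite subrr mulr0.
  under eq_integral do rewrite mul0r cos0 sin0 mule0 sube0 mule1.
  by rewrite integral_cst// [X in (_ * X)%E]lebesgue_measure_Omega mule1 sqn_Re.
have {}ji : i != j by rewrite eq_sym.
have icZ : leb.-integrable (Omega R N) (fun x => (a i j)%:E * (cos (t i j * x))%:E)%E.
  by apply: integrableZl => //; exact: icos.
have isZ : leb.-integrable (Omega R N) (fun x => (b i j)%:E * (sin (t i j * x))%:E)%E.
  by apply: integrableZl => //; exact: isin.
rewrite (integralB mO icZ isZ) (integralZl mO (icos _)) (integralZl mO (isin _)).
rewrite (integral_Omega_cos_sin N_gt0 (gap i j ji)).1.
by rewrite (integral_Omega_cos_sin N_gt0 (gap i j ji)).2 !mule0 sube0.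
Qed.

(** The dilated spectrum [2 N Lambda] lies in the even integers and its points
    stay distinct. Hence the multipliers of the displacement operators form an
    orthonormal family as well. *)
Lemma orthogonal_gap_dilate mu : orthogonal_gap N mu ->
  orthogonal_gap N ((2 * N)%:R * mu : R).
Proof.
move=> gap; have mu0 := orthogonal_gap_neq0 N_gt0 gap; left; split.
  by rewrite mulf_neq0// pnatr_eq0; lia.
case: gap => [[_ [k ->]]|[k muE]].
  by exists (2 * N%:Z * k); rewrite !rmorphM /= natrM; ring.
by exists (2 * k + 1); rewrite natrM -mulrA muE.
Qed.

(** The gap between points of the two different cosets is [+-r/N] plus an even
    integer: this is where [r] has to be odd. *)
Lemma Lambda_gap (r : nat) (l l' : Lambda R N r) : odd r -> l != l' ->
  orthogonal_gap N (val l - val l').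
Proof.
move=> r_odd ll'.
have NN0 : (N%:R : R) != 0 by rewrite pnatr_eq0 -lt0n.
have rE : r%:R = 2 * (r./2)%:R + 1 :> R.
  by rewrite -[in LHS](odd_double_half r) r_odd natrD -muln2 natrM addrC mulrC.
have [a ha [j _ aj]] := set_mem (valP l).
have [b hb [k _ bk]] := set_mem (valP l').
have even : a = b -> orthogonal_gap N (val l - val l').
  move=> ab; left; split; first by rewrite subr_eq0; apply: contra ll' => /eqP/val_inj ->.
  by exists (j - k); rewrite -aj -bk ab rmorphB /=; ring.
case: ha hb => ->[]-> in aj bk even *; try exact: even.
- right; exists (- (r./2)%:Z - 1 + N%:Z * (j - k)); rewrite -aj -bk.
  rewrite !(rmorphD, rmorphM, rmorphB, rmorphN) /=.
  rewrite rE; field. exact: NN0.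
- right; exists ((r./2)%:Z + N%:Z * (j - k)); rewrite -aj -bk.
  rewrite !(rmorphD, rmorphM, rmorphB, rmorphN) /=.
  by rewrite rE; field.
Qed.

End Orthonormality.

(** * Fourier series on [Omega] *)

Section Squeeze.
Context {R : realType} {I : choiceType}.

Lemma cvg_totally_e0P (delta : {fset I} -> \bar R) : (forall A, (0 <= delta A)%E) ->
  (delta A @[A --> totally] --> 0%E) <->
  (forall e : R, 0 < e -> \forall A \near totally, (delta A <= e%:E)%E).
Proof.
move=> d0; split=> [H e e0|H].
  have : nbhs (0%E : \bar R) [set x | (x < e%:E)%E].
    by apply: open_nbhs_nbhs; split; [exact: open_ereal_lt_ereal|rewrite /= lte_fin].
  move=> /H dA; have {}dA : \forall A \near totally, (delta A < e%:E)%E by exact: dA.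
  by apply: filterS dA => A /ltW.
apply/fine_cvgP; split.
  apply: filterS (H 1 ltr01) => A dA.
  by rewrite ge0_fin_numE// (le_lt_trans dA)// ltry.
apply/cvgrPdist_le => e e0; apply: filterS (H e e0) => A dA /=.
rewrite sub0r normrN ger0_norm ?fine_ge0// -lee_fin fineK//.
by rewrite ge0_fin_numE// (le_lt_trans dA)// ltry.
Qed.

(** Removes the factor [1 + e] introduced by [sqnD_le]. *)
Lemma le_of_perturbed (x y : R) : 0 <= y ->
  (forall e, 0 < e -> x <= (1 + e) * y + e) -> x <= y.
Proof.
move=> y0 H; apply/ler_addgt0Pr => e e0.
have y1 : 0 < y + 1 by lra.
apply: le_trans (H (e / (y + 1)) _) _; first by rewrite divr_gt0.
rewrite (_ : (1 + e / (y + 1)) * y + e / (y + 1) = y + e)//.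
by field; rewrite gt_eqF.
Qed.

End Squeeze.

Section FourierSum.
Context {R : realType} {N r : nat}.
Hypotheses (N_gt0 : (0 < N)%N) (r_odd : odd r).
Local Notation leb := (@lebesgue_measure R).
Local Notation L2 := (L2sq leb (Omega R N)).
Local Notation meas := (cmeas (Omega R N : set (measurableTypeR R))).
Implicit Types (c : Lambda R N r -> R[i]) (A B C : {fset Lambda R N r}) (F G : R -> R[i]).

Definition expsum c A (x : R) : R[i] :=
  partial_sum (fun l : Lambda R N r => c l * expi (2 * pi * val l * x)) A.

Let mO := measurable_Omega (R := R) N.

Lemma L2_OmegaP F : L2_Omega N F <-> meas F /\ (L2 F < +oo)%E.
Proof. by split=> [[? ? ?]|[[? ?] ?]]. Qed.

Lemma cmeas_expsum c A : meas (expsum c A).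
Proof.
apply: cmeas_sum => i; apply: (cmeasM (cmeas_cst _ _)).
by have := cmeas_expi (Omega R N) (2 * pi * val (val i)).
Qed.

Lemma L2_expsum c A : L2 (expsum c A) = (partial_sum (fun l => sqn (c l)) A)%:E.
Proof.
apply: (L2sq_trig N_gt0 (fun l : A => c (val l)) (phi := fun l : A => val (val l))).
by move=> i j ij; apply: Lambda_gap.
Qed.

Lemma eq_L2 F G : (forall x, sqn (F x) = sqn (G x)) -> L2 F = L2 G.
Proof. by move=> FG; apply: eq_integral => x _; rewrite FG. Qed.

Lemma L2_subC F G : L2 (fun x => F x - G x) = L2 (fun x => G x - F x).
Proof. by apply: eq_L2 => x; rewrite -sqnN opprB. Qed.

Lemma partial_sum_sub (V : zmodType) (u : Lambda R N r -> V) A B : (A `<=` B)%fset ->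
  partial_sum u A = partial_sum (fun l => if l \in A then u l else 0) B.
Proof.
move=> AB; rewrite !partial_sumE [RHS](big_fsetID _ (fun i => i \in A) B) /=.
rewrite (_ : [fset x in B | x \in A]%fset = A); last first.
  apply/fsetP => i; rewrite !inE /=.
  by case: (boolP (i \in A)) => [/(fsubsetP AB)->|]; rewrite ?andbF.
rewrite [X in _ = _ + X]big_seq [X in _ = _ + X]big1 ?addr0; last first.
  by move=> i; rewrite !inE /= => /andP[_ /negbTE->].
by rewrite [RHS]big_seq [LHS]big_seq; apply: eq_bigr => i ->.
Qed.

(** Only the coefficients outside a common subset [C] of [A] and [B] survive in
    the difference of the two partial sums. *)
Lemma L2_expsumB_le c A B C : (C `<=` A)%fset -> (C `<=` B)%fset ->
  (L2 (fun x => expsum c A x - expsum c B x)%R <=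
   (partial_sum (fun l => sqn (c l)) (A `|` B)%fset -
    partial_sum (fun l => sqn (c l)) C)%:E)%E.
Proof.
move=> CA CB.
pose d l := (if l \in A then c l else 0) - (if l \in B then c l else 0).
rewrite (@eq_L2 _ (expsum d (A `|` B)%fset)).
  rewrite L2_expsum lee_fin.
  rewrite (@partial_sum_sub _ _ C (A `|` B)%fset); last first.
    exact: fsubset_trans CA (fsubsetUl _ _).
  rewrite /partial_sum -sumrB; apply: ler_sum => l _.
  case: (boolP (val l \in C)) => lC.
    by rewrite /d (fsubsetP CA _ lC) (fsubsetP CB _ lC) !subrr sqn0.
  rewrite subr0 /d; case: ifP => _; case: ifP => _.
  - by rewrite subrr sqn0 sqn_ge0.
  - by rewrite subr0.
  - by rewrite sub0r sqnN.
  - by rewrite subrr sqn0 sqn_ge0.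
move=> x; congr (sqn _); rewrite /expsum.
rewrite (@partial_sum_sub _ _ A (A `|` B)%fset) ?fsubsetUl//.
rewrite (@partial_sum_sub _ _ B (A `|` B)%fset) ?fsubsetUr//.
rewrite /partial_sum -sumrB; apply: eq_bigr => l _.
by rewrite /d mulrBl; congr (_ - _); case: ifP; rewrite ?mul0r.
Qed.


Lemma fourier_sumP c F : fourier_sum c F <-> [/\ meas F, (L2 F < +oo)%E &
  forall e : R, 0 < e -> \forall A \near totally,
    (L2 (fun x => expsum c A x - F x)%R <= e%:E)%E].
Proof.
have d0 A : (0 <= L2 (fun x => expsum c A x - F x)%R)%E by exact: L2sq_ge0.
split=> [[/L2_OmegaP[mF F2] cF]|[mF F2 cF]].
  by split=> //; exact: ((cvg_totally_e0P d0).1 cF).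
by split; [exact/L2_OmegaP|exact: ((cvg_totally_e0P d0).2 cF)].
Qed.

(** Parseval's identity. The squared norms of the partial sums are known by
    orthonormality, and [L2sqD_le] compares them with that of the limit in both
    directions, up to a factor [1 + e]. *)
Lemma parseval c F : fourier_sum c F ->
  L2 F = (\esum_(l in [set: Lambda R N r]) (sqn (c l))%:E)%E.
Proof.
move=> /fourier_sumP[mF F2 cF].
have c0 l : 0 <= sqn (c l) by exact: sqn_ge0.
have L2F0 := L2sq_ge0 leb (Omega R N) F.
have FE : (fine (L2 F))%:E = L2 F by rewrite fineK// ge0_fin_numE.
have small e : 0 < e -> \forall A \near totally,
    ((1 + e^-1)%:E * L2 (fun x => expsum c A x - F x)%R <= e%:E)%E.
  move=> e0; have e1 : 0 < 1 + e^-1 by rewrite addr_gt0// invr_gt0.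
  apply: filterS (cF (e / (1 + e^-1)) (divr_gt0 e0 e1)) => A dA.
  apply: le_trans (lee_wpmul2l _ dA) _; first by rewrite lee_fin ltW.
  by rewrite -EFinM lee_fin mulrCA divff ?gt_eqF// mulr1.
have le_q A : partial_sum (fun l => sqn (c l)) A <= fine (L2 F).
  apply: le_of_perturbed; first exact: fine_ge0.
  move=> e e0.
  have near_A : \forall B \near totally, (A `<=` B)%fset.
    by apply: (near_totally (A := A)).
  have [B [AB dB]] := filter_ex (filterI near_A (small e e0)).
  apply: le_trans (le_partial_sum c0 AB) _.
  rewrite -lee_fin -L2_expsum EFinD EFinM FE.
  rewrite (@eq_L2 _ (fun x => F x + (expsum c B x - F x))); last first.
    by move=> x; rewrite addrC subrK.
  apply: le_trans (L2sqD_le leb mO e0 mF (cmeasB (cmeas_expsum c B) mF)) _.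
  exact: leeD2l.
have q_le : (\esum_(l in [set: Lambda R N r]) (sqn (c l))%:E <= L2 F)%E.
  by apply: esum_le_partial_sum => A; rewrite -FE lee_fin.
apply/eqP; rewrite eq_le q_le andbT.
set Q := (\esum_(l in _) _)%E in q_le *.
have Q0 : (0 <= Q)%E by apply: esum_ge0 => l _; rewrite lee_fin.
have QE : (fine Q)%:E = Q by rewrite fineK// ge0_fin_numE// (le_lt_trans q_le).
rewrite -FE -QE lee_fin; apply: le_of_perturbed; first exact: fine_ge0.
move=> e e0; have [B dB] := filter_ex (small e e0).
rewrite -lee_fin FE EFinD EFinM QE.
rewrite (@eq_L2 _ (fun x => expsum c B x + (F x - expsum c B x))); last first.
  by move=> x; rewrite addrC subrK.
apply: le_trans (L2sqD_le leb mO e0 (cmeas_expsum c B)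
  (cmeasB mF (cmeas_expsum c B))) _.
rewrite L2_subC; apply: leeD dB; apply: lee_wpmul2l; first by rewrite lee_fin; lra.
by rewrite L2_expsum; exact: partial_sum_le_esum.
Qed.

(** Riesz-Fischer applied to partial sums over an increasing sequence of finite
    sets [B k] whose complements carry at most [8^-k] of the total mass. Since
    [L2_expsumB_le] controls every finite set that contains [B k], the limit is
    attained along all finite sets. *)
Lemma fourier_sum_exists c :
  (\esum_(l in [set: Lambda R N r]) (sqn (c l))%:E < +oo)%E ->
  exists F, fourier_sum c F.
Proof.
move=> c2; set Q := (\esum_(l in _) _)%E in c2.
pose q A := partial_sum (fun l => sqn (c l)) A.
have c0 l : 0 <= sqn (c l) by exact: sqn_ge0.
have Q0 : (0 <= Q)%E by apply: esum_ge0 => l _; rewrite lee_fin.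
have QE : (fine Q)%:E = Q by rewrite fineK// ge0_fin_numE.
have qQ A : q A <= fine Q by rewrite -lee_fin QE; exact: partial_sum_le_esum.
have ep_gt0 k : 0 < 8^-1 ^+ k :> R by rewrite exprn_gt0// invr_gt0.
have /choice[E QE_le] : forall k, exists A, fine Q - 8^-1 ^+ k <= q A.
  move=> k; have /cvgrPdist_le/(_ _ (ep_gt0 k)) := cvg_partial_sum_ge0 c0 c2.
  move=> /filter_ex[A]; rewrite ger0_norm ?subr_ge0//.
  by rewrite lerBlDr -lerBlDl => ?; exists A.
pose B := nat_rect (fun _ => {fset Lambda R N r}) (E 0%N)
  (fun k Bk => (Bk `|` E k.+1)%fset).
have EB k : (E k `<=` B k)%fset by case: k => [|k] //=; exact: fsubsetUr.
have BB j k : (j <= k)%N -> (B j `<=` B k)%fset.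
  elim: k => [|k IH]; first by rewrite leqn0 => /eqP->.
  rewrite leq_eqVlt => /predU1P[->//|/IH jk].
  exact: fsubset_trans jk (fsubsetUl _ _).
have close k A A' : (B k `<=` A)%fset -> (B k `<=` A')%fset ->
    (L2 (fun x => expsum c A x - expsum c A' x)%R <= (8^-1 ^+ k)%:E)%E.
  move=> BA BA'; apply: le_trans (L2_expsumB_le c BA BA') _.
  rewrite lee_fin.
  have := QE_le k; have := le_partial_sum c0 (EB k); have := qQ (A `|` A')%fset.
  rewrite /q; lra.
have [F [mF FB]] := @riesz_fischer _ _ _ leb (Omega R N) mO (fun k => expsum c (B k))
  (fun k => cmeas_expsum c (B k))
  (fun k => close k _ _ (BB _ _ (leqnSn k)) (BB _ _ (leqnn k))).
have near_F k A : (B k `<=` A)%fset ->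
    (L2 (fun x => expsum c A x - F x)%R <= (8^-1 ^+ k)%:E)%E.
  move=> BA; apply: (FB _ k) => [|j kj]; first exact: cmeas_expsum.
  by apply: close => //; exact: BB.
exists F; apply/fourier_sumP; split=> //.
  rewrite (@eq_L2 _
    (fun x => expsum c (B 0%N) x + (F x - expsum c (B 0%N) x))); last first.
    by move=> x; rewrite addrC subrK.
  apply: le_lt_trans (L2sqD_le leb mO ltr01 (cmeas_expsum _ _)
    (cmeasB mF (cmeas_expsum _ _))) _.
  apply: lte_add_pinfty; apply: lte_mul_pinfty => //.
  - by rewrite L2_expsum ltry.
  - rewrite L2_subC; apply: le_lt_trans (near_F 0%N _ (BB _ _ (leqnn _))) _.
    exact: ltry.
move=> e e0.
have [k ke] : exists k, 8^-1 ^+ k <= e.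
  have : 8^-1 ^+ k @[k --> \oo] --> (0 : R).
    by apply: cvg_expr; rewrite ger0_norm ?invr_ge0// invf_lt1// ltr1n.
  move=> /cvgrPdist_le/(_ e e0) /filter_ex[k].
  by rewrite sub0r normrN ger0_norm ?(ltW (ep_gt0 k))// => ke; exists k.
apply: (near_totally (A := B k)) => A BA; apply: le_trans (near_F k A BA) _.
by rewrite lee_fin.
Qed.

Lemma fourier_sum0 : fourier_sum (fun _ : Lambda R N r => 0) (fun _ => 0).
Proof.
have L20 : L2 (cst 0) = 0%E by apply: integral0_eq => x _; rewrite sqn0.
apply/fourier_sumP; split; [exact: (cmeas_cst _ 0)|by rewrite L20 ltry|].
move=> e e0; apply: nearW => A.
rewrite (@eq_L2 _ (cst 0)) ?L20 ?lee_fin ?ltW// => x.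
by rewrite /expsum /partial_sum big1 ?subr0// => l _; rewrite mul0r.
Qed.

Lemma fourier_sumZD (a : R[i]) c c' F F' : fourier_sum c F -> fourier_sum c' F' ->
  fourier_sum (fun l => a * c l + c' l) (fun x => a * F x + F' x).
Proof.
move=> /fourier_sumP[mF F2 cF] /fourier_sumP[mF' F2' cF'].
have a0 := sqn_ge0 a.
have L2ZD G G' : meas G -> meas G' ->
    (L2 (fun x => a * G x + G' x)%R <= (2 * sqn a)%:E * L2 G + 2%:E * L2 G')%E.
  move=> mG mG'.
  apply: le_trans (L2sqD_le leb mO ltr01 (cmeasM (cmeas_cst _ a) mG) mG') _.
  rewrite invr1 (_ : 1 + 1 = 2 :> R)// EFinM -muleA leeD2r// lee_wpmul2l//.
  rewrite /L2sq -ge0_integralZl_EFin//; last 2 first.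
  - by move=> x _; rewrite lee_fin sqn_ge0.
  - exact: measurable_EFin_sqn.
  by under eq_integral do rewrite sqnM EFinM.
apply/fourier_sumP; split.
- by apply: cmeasD => //; apply: cmeasM => //; exact: cmeas_cst.
- apply: le_lt_trans (L2ZD _ _ mF mF') _.
  by apply: lte_add_pinfty; apply: lte_mul_pinfty => //; rewrite lee_fin mulr_ge0.
move=> e e0.
have d1 : 0 < e / (4 * (sqn a + 1)) by rewrite divr_gt0// mulr_gt0//; lra.
have d2 : 0 < e / 4 by lra.
apply: filterS (filterI (cF _ d1) (cF' _ d2)) => A [dA dA'].
rewrite (@eq_L2 _
  (fun x => a * (expsum c A x - F x) + (expsum c' A x - F' x))); last first.
  move=> x; congr (sqn _); rewrite /expsum /partial_sum.
  under eq_bigr do rewrite mulrDl -mulrA.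
  by rewrite big_split /= -mulr_sumr; ring.
apply: le_trans
  (L2ZD _ _ (cmeasB (cmeas_expsum _ _) mF) (cmeasB (cmeas_expsum _ _) mF')) _.
have a2 : (0 <= (2 * sqn a)%:E)%E by rewrite lee_fin mulr_ge0.
have t2 : (0 <= 2%:E :> \bar R)%E by rewrite lee_fin.
apply: le_trans (leeD (lee_wpmul2l a2 dA) (lee_wpmul2l t2 dA')) _.
rewrite -!EFinM -EFinD lee_fin.
have -> : 2 * sqn a * (e / (4 * (sqn a + 1))) = e / 2 * (sqn a / (sqn a + 1)).
  by field; rewrite gt_eqF//; lra.
have : sqn a / (sqn a + 1) <= 1 by rewrite ler_pdivrMr; lra.
have : 0 < e / 2 by lra.
move=> e2 /(ler_wpM2l (ltW e2)); lra.
Qed.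

Lemma fourier_sum_sum (I : Type) (s : seq I) (a : I -> R[i])
    (c : I -> Lambda R N r -> R[i]) (F : I -> R -> R[i]) :
  (forall i, fourier_sum (c i) (F i)) ->
  fourier_sum (fun l => \sum_(i <- s) a i * c i l) (fun x => \sum_(i <- s) a i * F i x).
Proof.
move=> cF; elim: s => [|i s IH].
  rewrite (_ : (fun l => _) = fun _ => 0); last by apply/funext => l; rewrite big_nil.
  rewrite (_ : (fun x => _) = fun _ => 0); last by apply/funext => x; rewrite big_nil.
  exact: fourier_sum0.
rewrite (_ : (fun l => _) = fun l => a i * c i l + \sum_(j <- s) a j * c j l); last first.
  by apply/funext => l; rewrite big_cons.
rewrite (_ : (fun x => _) = fun x => a i * F i x + \sum_(j <- s) a j * F j x); last first.
  by apply/funext => x; rewrite big_cons.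
exact: fourier_sumZD.
Qed.

Definition shiftL (l l' : Lambda R N r) : Lambda R N r :=
  exist _ (val l' - (2 * N)%:R * val l) (Lambda_shift l l').

Lemma shiftL_inj l : injective (shiftL l).
Proof. by move=> x y /(congr1 val) /= /addIr /val_inj. Qed.

(** The translation amount [2 N l] is an even integer and [Lambda] is invariant
    under those; [- l] itself need not belong to [Lambda]. *)
Lemma shiftL_surj l l' : exists l'', shiftL l l'' = l'.
Proof.
have H : val l' + (2 * N)%:R * val l \in Lambda R N r.
  have [k kE] : exists k : int, (2 * N)%:R * val l = 2 * k%:~R :> R.
    have [a ha [j _ <-]] := set_mem (valP l).
    have NN0 : (N%:R : R) != 0 by rewrite pnatr_eq0 -lt0n.
    case: ha => ->.
      by exists (2 * N%:Z * j); rewrite !rmorphM /=; ring.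
    exists (r%:Z + 2 * N%:Z * j); rewrite !(rmorphD, rmorphM) /=; field.
    exact: NN0.
  have [b hb [j _ <-]] := set_mem (valP l').
  by apply/mem_set; exists b => //; exists (j + k) => //; rewrite kE rmorphD /=; ring.
by exists (exist (fun x => x \in Lambda R N r) _ H); apply: val_inj => /=; rewrite addrK.
Qed.

(** A translation of the coefficients by [2 N l] multiplies the partial sums,
    reindexed by the translated index sets, by a unimodular function. *)
Lemma fourier_sum_shift l c F : fourier_sum c F ->
  fourier_sum (c \o shiftL l) (fun x => expi (2 * pi * ((2 * N)%:R * val l) * x) * F x).
Proof.
set e := fun x : R => expi (2 * pi * ((2 * N)%:R * val l) * x).
move=> /fourier_sumP[mF F2 cF].
have me : meas e := cmeas_expi _ _.
have L2e G : L2 (fun x => e x * G x) = L2 G.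
  by apply: eq_L2 => x; rewrite sqnM sqn_expi mul1r.
apply/fourier_sumP; split; [exact: cmeasM|by rewrite L2e|].
move=> d d0; have [A0 _ hA0] := cF d d0.
have /choice[inv invK] := shiftL_surj l.
apply: (near_totally (A := [fset inv x | x in A0]%fset)) => A A0A.
rewrite (@eq_L2 _ (fun x => e x * (expsum c [fset shiftL l y | y in A]%fset x - F x))).
  rewrite L2e; apply: hA0 => /=; apply/fsubsetP => y yA0.
  apply/imfsetP; exists (inv y); last by rewrite invK.
  by apply: (fsubsetP A0A); apply/imfsetP; exists y.
move=> x; congr (sqn _); rewrite mulrBr; congr (_ - _).
rewrite /expsum !partial_sumE big_imfset /=; last by move=> ? ? _ _; exact: shiftL_inj.
rewrite mulr_sumr; apply: eq_bigr => y _.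
rewrite mulrCA -expiD; congr (_ * expi _).
by rewrite -[\val l]/(sval l); move: (sval y) (sval l) => u v; ring.
Qed.

End FourierSum.

(** * Combinations of translates *)

Section Combinations.
Context {R : realType} {n N r : nat}.
Hypotheses (N_gt0 : (0 < N)%N) (r_odd : odd r).
Local Notation leb := (@lebesgue_measure R).
Local Notation L2 := (L2sq leb (Omega R N)).
Implicit Types (f g h : Lambda R N r -> 'M[R[i]]_n).

Let mO := measurable_Omega (R := R) N.

(** On square-summable sequences the choice made by [fourier] really picks a sum
    of the series. *)
Lemma fourier_entry f : ell2 f -> forall m k,
  fourier_sum (fun l => f l m k) (fun x => fourier f x m k).
Proof.
move=> f2 m k.
rewrite (_ : (fun x => _) = xget (cst 0) [set F | fourier_sum (fun l => f l m k) F]).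
  apply: xgetPex; apply: (fourier_sum_exists N_gt0 r_odd).
  apply: le_lt_trans f2; apply: le_esum => l _; rewrite lee_fin.
  rewrite (bigD1 m)//= (bigD1 k)//= -addrA lerDl addr_ge0//.
    by apply: sumr_ge0 => ? _; exact: sqn_ge0.
  by apply: sumr_ge0 => ? _; apply: sumr_ge0 => ? _; exact: sqn_ge0.
by apply/funext => x; rewrite /fourier mxE.
Qed.

Lemma measurable_mxsqn (H : R -> 'M[R[i]]_n) :
  (forall m k, cmeas (Omega R N : set (measurableTypeR R)) (fun x => H x m k)) ->
  measurable_fun (Omega R N : set (measurableTypeR R)) (fun x => mxsqn (H x)).
Proof.
move=> mH; apply: measurable_sum => m; apply: measurable_sum => k.
exact: measurable_sqn.
Qed.

Section MatrixParseval.
Variables (h : Lambda R N r -> 'M[R[i]]_n) (H : R -> 'M[R[i]]_n).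
Hypothesis hH : forall m k, fourier_sum (fun l => h l m k) (fun x => H x m k).

Let mH m k : cmeas (Omega R N : set (measurableTypeR R)) (fun x => H x m k).
Proof. by have /fourier_sumP[] := hH m k. Qed.

Lemma matrix_parseval :
  (\int[leb]_(x in Omega R N) (mxsqn (H x))%:E =
   \esum_(l in [set: Lambda R N r]) (mxsqn (h l))%:E)%E.
Proof.
rewrite /mxsqn.
under eq_esum do rewrite -sumEFin.
under eq_integral do rewrite -sumEFin.
rewrite esum_sum; last first.
  by move=> l m _ _; rewrite lee_fin; apply: sumr_ge0 => k _; exact: sqn_ge0.
rewrite ge0_integral_sum//; last 2 first.
- move=> m; apply/measurable_EFinP; apply: measurable_sum => k; exact: measurable_sqn.
- by move=> m x _; rewrite lee_fin; apply: sumr_ge0 => k _; exact: sqn_ge0.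
apply: eq_bigr => m _.
under eq_esum do rewrite -sumEFin.
under eq_integral do rewrite -sumEFin.
rewrite esum_sum; last by move=> l k _ _; rewrite lee_fin sqn_ge0.
rewrite ge0_integral_sum//; last 2 first.
- by move=> k; exact: measurable_EFin_sqn.
- by move=> k x _; rewrite lee_fin sqn_ge0.
by apply: eq_bigr => k _; exact: (parseval N_gt0 r_odd (hH m k)).
Qed.

Lemma ell2_of_fourier : ell2 h.
Proof.
rewrite /ell2.
under eq_esum do rewrite -sumEFin.
rewrite esum_sum; last first.
  by move=> l m _ _; rewrite lee_fin; apply: sumr_ge0 => k _; exact: sqn_ge0.
apply: lte_sum_pinfty => m _.
under eq_esum do rewrite -sumEFin.
rewrite esum_sum; last by move=> l k _ _; rewrite lee_fin sqn_ge0.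
apply: lte_sum_pinfty => k _.
rewrite -(parseval N_gt0 r_odd (hH m k)).
by have /fourier_sumP[] := hH m k.
Qed.

End MatrixParseval.

Definition combine (I : Type) (s : seq I) (a : I -> R[i]) (lam : I -> Lambda R N r) f :
    Lambda R N r -> 'M[R[i]]_n :=
  fun l => \sum_(i <- s) a i *: displace (lam i) f l.

(** The factor by which [combine s a lam] acts after Fourier transform. *)
Definition multiplier (I : Type) (s : seq I) (a : I -> R[i]) (lam : I -> Lambda R N r)
    (x : R) : R[i] :=
  \sum_(i <- s) a i * expi (2 * pi * ((2 * N)%:R * val (lam i)) * x).

Lemma fourier_combine (I : Type) (s : seq I) (a : I -> R[i]) (lam : I -> Lambda R N r) f :
  ell2 f -> forall m k, fourier_sum (fun l => combine s a lam f l m k)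
    (fun x => (multiplier s a lam x *: fourier f x) m k).
Proof.
move=> f2 m k.
have := fourier_sum_sum s a
  (fun i => fourier_sum_shift N_gt0 (lam i) (fourier_entry f2 m k)).
rewrite (_ : (fun l => _) = fun l => combine s a lam f l m k); last first.
  by apply/funext => l; rewrite /combine summxE; apply: eq_bigr => i _; rewrite mxE.
rewrite (_ : (fun x => _) = fun x => (multiplier s a lam x *: fourier f x) m k)//.
apply/funext => x; rewrite [RHS]mxE /multiplier mulr_suml.
by apply: eq_bigr => i _; rewrite mulrA.
Qed.

Lemma ell2_combine (I : Type) (s : seq I) a (lam : I -> Lambda R N r) f :
  ell2 f -> ell2 (combine s a lam f).
Proof. by move=> f2; exact: (ell2_of_fourier (fourier_combine s a lam f2)). Qed.

Lemma ell2_displace l f : ell2 f -> ell2 (displace l f).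
Proof.
move=> f2; rewrite (_ : displace l f = combine [:: tt] (fun=> 1) (fun=> l) f).
  exact: ell2_combine.
by apply/funext => l'; rewrite /combine big_seq1 scale1r.
Qed.

Lemma mxsqnZ (z : R[i]) (a : 'M[R[i]]_n) : mxsqn (z *: a) = sqn z * mxsqn a.
Proof.
rewrite /mxsqn mulr_sumr; apply: eq_bigr => m _.
by rewrite mulr_sumr; apply: eq_bigr => k _; rewrite mxE sqnM.
Qed.

(** The operators [combine] are multiplication operators on the Fourier side, so
    their norm is governed by [mxsqn (fourier f x)] alone. *)
Lemma norm_combine (I : Type) (s : seq I) a (lam : I -> Lambda R N r) f : ell2 f ->
  ((ell2_norm (combine s a lam f) ^+ 2)%:E =
   \int[leb]_(x in Omega R N) (sqn (multiplier s a lam x) * mxsqn (fourier f x))%:E)%E.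
Proof.
move=> f2; rewrite sqr_ell2_norm; last exact: ell2_combine.
rewrite -(matrix_parseval (fourier_combine s a lam f2)).
by apply: eq_integral => x _; rewrite mxsqnZ.
Qed.

(** By [orthogonal_gap_dilate], distinct displacements have orthogonal
    multipliers. *)
Lemma L2_multiplier (A : {fset Lambda R N r}) (a : Lambda R N r -> R[i]) :
  L2 (multiplier (index_enum A) (a \o val) val) =
  (partial_sum (fun l => sqn (a l)) A)%:E.
Proof.
apply: (L2sq_trig N_gt0 (fun l : A => a (val l))
  (phi := fun l : A => (2 * N)%:R * val (val l))) => i j ij.
rewrite -mulrBr; apply: orthogonal_gap_dilate => //.
by apply: Lambda_gap => //.
Qed.

Lemma measurable_fourier f : ell2 f ->
  measurable_fun (Omega R N : set (measurableTypeR R)) (fun x => mxsqn (fourier f x)).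
Proof.
move=> f2; apply: measurable_mxsqn => m k.
by have /fourier_sumP[] := fourier_entry f2 m k.
Qed.

Lemma cmeas_multiplier (I : Type) (s : seq I) a (lam : I -> Lambda R N r) :
  cmeas (Omega R N : set (measurableTypeR R)) (multiplier s a lam).
Proof.
apply: cmeas_sum => i; apply: (cmeasM (cmeas_cst _ _)).
by have := cmeas_expi (Omega R N) (2 * pi * ((2 * N)%:R * val (lam i))).
Qed.

(** With [s] the partial sum over [A] and [h] the combination of the
    displacements weighted by the very coefficients [<g, D_(2Nl) f>], one has
    [s = <g, h>] and [||h||^2 <= b0^2 s], so Cauchy-Schwarz gives
    [s^2 <= b0^2 ||g||^2 s]. *)
Lemma bessel_of_bounded f (b0 : R) : ell2 f -> 0 < b0 ->
  {ae leb, forall x : R, Omega R N x -> mxnorm (fourier f x) <= b0} ->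
  forall g, ell2 g ->
  (\esum_(l in [set: Lambda R N r]) (sqn (ell2_inner g (displace l f)))%:E
     <= (b0 ^+ 2 * ell2_norm g ^+ 2)%:E)%E.
Proof.
move=> f2 b0_gt0 Fb g g2; apply: esum_le_partial_sum => A; rewrite lee_fin.
pose a l := ell2_inner g (displace l f).
set s := partial_sum _ A.
have s_ge0 : 0 <= s by apply: partial_sum_ge0 => l; exact: sqn_ge0.
pose h := combine (index_enum A) (a \o val) val f.
have h2 : ell2 h by exact: ell2_combine.
have gh : ell2_inner g h = s%:C%C.
  rewrite (ell2_inner_sumr (index_enum A) (a \o val) g2
    (fun i : A => ell2_displace (val i) f2)).
  rewrite /s /partial_sum rmorph_sum; apply: eq_bigr => i _ /=.
  by rewrite mulrC mul_conjE.
have hb : ell2_norm h ^+ 2 <= b0 ^+ 2 * s.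
  rewrite -lee_fin norm_combine// EFinM -L2_multiplier.
  have mP := cmeas_multiplier (index_enum A) (a \o val) val.
  have mP2 := measurable_EFin_sqn mP.
  rewrite /L2sq -ge0_integralZl_EFin//; last 2 first.
  - by move=> x _; rewrite lee_fin sqn_ge0.
  - exact: sqr_ge0.
  apply: ae_ge0_le_integral => //.
  - by move=> x _; rewrite lee_fin mulr_ge0 ?sqn_ge0 ?mxsqn_ge0.
  - apply/measurable_EFinP; apply: measurable_funM; first exact: measurable_sqn.
    exact: measurable_fourier.
  - by move=> x _; rewrite -EFinM lee_fin mulr_ge0 ?sqn_ge0 ?sqr_ge0.
  - exact: emeasurable_funM.
  apply: (@filterS _ _ (ae_filter_ringOfSetsType leb) _ _ _ Fb) => x Fx Ox.
  rewrite -EFinM lee_fin mulrC ler_wpM2r ?sqn_ge0//.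
  by rewrite -sqr_mxnorm ler_pXn2r ?nnegrE ?sqrtr_ge0 ?(ltW b0_gt0)//; exact: Fx.
have := ell2_inner_CS g2 h2; rewrite gh sqn_real => CS.
have [->|s0] := eqVneq s 0; first by rewrite mulr_ge0 ?sqr_ge0.
have s_gt0 : 0 < s by rewrite lt_def s0.
rewrite -(ler_pM2r s_gt0) -expr2; apply: le_trans CS _.
by rewrite [leRHS]mulrAC mulrC ler_wpM2r ?sqr_ge0.
Qed.

(** The Bessel inequality bounds analysis; this is the dual bound on synthesis.
    For [h] the combination, expand [||h||^2 = <h, h>] in the second argument
    and apply the Bessel inequality to [h] itself. *)
Lemma synthesis_bound f (b : R) : ell2 f -> 0 < b ->
  (forall g, ell2 g ->
    (\esum_(l in [set: Lambda R N r]) (sqn (ell2_inner g (displace l f)))%:E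
     <= (b * ell2_norm g ^+ 2)%:E)%E) ->
  forall (A : {fset Lambda R N r}) (a : Lambda R N r -> R[i]),
  (\int[leb]_(x in Omega R N)
     (sqn (multiplier (index_enum A) (a \o val) val x) * mxsqn (fourier f x))%:E
   <= (b * partial_sum (fun l => sqn (a l)) A)%:E)%E.
Proof.
move=> f2 b_gt0 fb A a; rewrite -norm_combine// lee_fin.
set h := combine _ _ _ _; set S := partial_sum _ A; set t := ell2_norm h ^+ 2.
have h2 : ell2 h by exact: ell2_combine.
have t_ge0 : 0 <= t by exact: sqr_ge0.
have S_ge0 : 0 <= S by apply: partial_sum_ge0 => l; exact: sqn_ge0.
have t2 : t ^+ 2 <= b * t * S.
  rewrite -sqn_real -ell2_inner_selfE//.
  have -> : ell2_inner h h =
      \sum_(i : A) (a (val i))^* * ell2_inner h (displace (val i) f).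
    exact: (ell2_inner_sumr (index_enum A) (a \o val) h2
      (fun i : A => ell2_displace (val i) f2)).
  under eq_bigr do rewrite mulrC.
  apply: le_trans (sqn_sum_CS _ _ _) _; apply: ler_wpM2r => //.
  rewrite -lee_fin; apply: le_trans (fb h h2).
  by apply: partial_sum_le_esum => l; exact: sqn_ge0.
have [->|t0] := eqVneq t 0; first by rewrite mulr_ge0// ltW.
have t_gt0 : 0 < t by rewrite lt_def t0.
by rewrite -(ler_pM2r t_gt0) -expr2 mulrAC.
Qed.

End Combinations.

(** * From averages to pointwise bounds *)

Section Localization.
Context {R : realType}.
Local Notation leb := (@lebesgue_measure R).

(** At a Lebesgue point the value is the limit of the averages, hence it is
    bounded by any common bound of the averages over balls shrinking to the
    point. *)
Lemma lebesgue_pt_le (w : R -> R) (t K : R) (rho : nat -> R) :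
  (forall x, 0 <= w x) -> measurable_fun [set: R] w -> lebesgue_pt w t ->
  (forall k, 0 < rho k) -> rho k @[k --> \oo] --> (0 : R) ->
  (forall k, (\int[leb]_(x in ball t (rho k)) (w x)%:E <= (K * (rho k *+ 2))%:E)%E) ->
  w t <= K.
Proof.
move=> w0 mw wt rho0 rho_cvg wK; apply/ler_addgt0Pr => e e0.
have : nbhs (0%E : \bar R) [set x | (x < e%:E)%E].
  by apply: open_nbhs_nbhs; split; [exact: open_ereal_lt_ereal|rewrite /= lte_fin].
move=> /wt near_e.
have [d /= d0 hd] : nbhs (0 : R) [set s | 0 < s -> (davg w t s < e%:E)%E].
  exact: near_e.
have [k hk] : exists k, rho k < d.
  have /cvgrPdist_lt/(_ d d0)/filter_ex[k] := rho_cvg.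
  by rewrite sub0r normrN gtr0_norm// => kd; exists k.
have rk := rho0 k; have vol := lebesgue_measure_ball t (ltW rk).
set B := ball t (rho k) in wK *.
have mB : measurable (B : set (measurableTypeR R)) by exact: measurable_ball.
have mwB : measurable_fun (B : set (measurableTypeR R)) w by exact: measurable_funTS.
have dev : (\int[leb]_(x in B) `|w x - w t|%:E <= (e * (rho k *+ 2))%:E)%E.
  have : (davg w t (rho k) < e%:E)%E.
    by apply: hd => //=; rewrite sub0r normrN gtr0_norm.
  rewrite /davg /iavg vol inver gt_eqF ?mulrn_wgt0//.
  by move=> /ltW; rewrite lee_pdivrMl ?mulrn_wgt0// -EFinM mulrC.
have r2 : 0 < rho k *+ 2 by rewrite mulrn_wgt0.
rewrite -(ler_pM2r r2) -lee_fin.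
have -> : ((w t * (rho k *+ 2))%:E = \int[leb]_(x in B) (w t)%:E)%E.
  by rewrite integral_cst// [X in (_ * X)%E]vol.
apply: (@le_trans _ _ (\int[leb]_(x in B) ((w x)%:E + `|w x - w t|%:E))%E).
  apply: ge0_le_integral => //.
  - by move=> x _; rewrite lee_fin.
  - apply: emeasurable_funD; apply/measurable_EFinP => //.
    by apply: measurableT_comp => //; exact: measurable_funB.
  - move=> x _; rewrite -EFinD lee_fin -lerBlDl -normrN opprB; exact: ler_norm.
have mdw : measurable_fun (B : set (measurableTypeR R)) (fun x => `|w x - w t|%:E).
  by apply/measurable_EFinP; apply: measurableT_comp => //; exact: measurable_funB.
have mwE : measurable_fun (B : set (measurableTypeR R)) (fun x => (w x)%:E).
  exact/measurable_EFinP.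
rewrite ge0_integralD//; last by move=> x _; rewrite lee_fin.
by rewrite mulrDl EFinD; exact: leeD (wK k) dev.
Qed.

Lemma cos_ge_cos1 (u : R) : `|u| <= 1 -> cos 1 <= cos u.
Proof.
move=> u1; rewrite -(cos_norm u).
have pi2 := @pi_ge2 R.
by rewrite leNgt ltr_cos ?in_itv /= -?leNgt// ?normr_ge0 ?ler01 /=; lra.
Qed.

End Localization.

Section BoundedSymbol.
Context {R : realType} {n N r : nat}.
Hypotheses (N_gt0 : (0 < N)%N) (r_odd : odd r).
Local Notation leb := (@lebesgue_measure R).
Let mO := measurable_Omega (R := R) N.

Lemma even_in_Lambda (k : nat) : (2 * k%:R : R) \in Lambda R N r.
Proof.
by apply/mem_set; exists 0; [left|exists k%:Z => //; rewrite add0r].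
Qed.

Definition evenL (k : nat) : Lambda R N r :=
  exist (fun x => x \in Lambda R N r) _ (even_in_Lambda k).

Lemma evenL_inj : injective evenL.
Proof.
move=> j k /(congr1 val) /= /mulfI; rewrite pnatr_eq0 => /(_ isT) /eqP.
by rewrite eqr_nat => /eqP.
Qed.

(** The coset [2 Z] of [Lambda] is enough to concentrate a multiplier: the
    dilates of these points are the frequencies [4 N k]. *)
Definition evens (M : nat) : {fset Lambda R N r} := [fset evenL k | k in iota 0 M]%fset.

(** These coefficients bring all the exponentials [e_(2Nl)] to the value one at
    the point [t]. *)
Definition tuned (t : R) (l : Lambda R N r) : R[i] :=
  expi (- (2 * pi * ((2 * N)%:R * val l) * t)).

Lemma sum_evens_const M (c : R) : \sum_(l : evens M) c = c * M%:R.
Proof.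
rewrite sumr_const -cardfE card_imfset ?evenL_inj//=; last exact: evenL_inj.
by rewrite undup_id ?iota_uniq// size_iota mulr_natr.
Qed.

(** Near [t] the [M] tuned exponentials are in phase, so their sum has modulus
    of order [M], whereas its coefficients have square sum [M] only. *)
Lemma multiplier_peak M (t x : R) : `|x - t| < (8 * pi * N%:R * M.+1%:R)^-1 ->
  (cos 1 * M.+1%:R) ^+ 2 <=
  sqn (multiplier (index_enum (evens M.+1)) (tuned t \o val) val x).
Proof.
move=> xt; have pi0 := @pi_gt0 R; have cos1 := @cos1_gt0 R.
have N0 : 0 < N%:R :> R by rewrite ltr0n.
have Re_ge : cos 1 * M.+1%:R <=
    complex.Re (multiplier (index_enum (evens M.+1)) (tuned t \o val) val x).
  rewrite -sum_evens_const /multiplier Re_sum; apply: ler_sum => l _.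
  have [k kM lE] : exists2 k, (k < M.+1)%N & val l = evenL k.
    have /imfsetP[k /= kM ->] := valP l; exists k => //.
    by move: kM; rewrite -[0%N :: _]/(iota 0 M.+1) mem_iota.
  rewrite lE.
  rewrite [X in complex.Re X](_ : _ = expi (8 * pi * N%:R * k%:R * (x - t)));
    last first.
    rewrite -[(_ \o _) _]/(tuned t (val l)) lE -expiD.
    by congr expi; rewrite -[val (evenL k)]/(2 * k%:R) natrM; ring.
  (* The phases 8 pi N k (x - t), k <= M, stay in [-1, 1] on this ball. *)
  apply: cos_ge_cos1; rewrite normrM ger0_norm ?mulr_ge0 ?pi_ge0//.
  have kM' : k%:R <= M.+1%:R :> R by rewrite ler_nat ltnW.
  have C0 : 0 < 8 * pi * N%:R :> R by apply: mulr_gt0 => //; apply: mulr_gt0.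
  apply: (@le_trans _ _ (8 * pi * N%:R * M.+1%:R * (8 * pi * N%:R * M.+1%:R)^-1)).
    by apply: ler_pM => //; rewrite ?mulr_ge0 ?pi_ge0// ?(ltW xt)// ler_pM2l.
  by rewrite mulfV// gt_eqF// mulr_gt0// ltr0n.
rewrite sqnE -[leLHS]addr0 lerD ?sqr_ge0//.
by rewrite ler_pXn2r ?nnegrE ?mulr_ge0 ?(ltW cos1)// (le_trans _ Re_ge)// mulr_ge0// ltW.
Qed.

(** Testing [synthesis_bound] on the multiplier that peaks at [t] gives
    [(M cos 1)^2 int_ball ||F||^2 <= b M] on a ball of length
    [2 / (8 pi N M)]; the quotient [4 pi N b / (cos 1)^2] bounds the average of
    [||F||^2] uniformly in [M] and [t]. *)
Lemma bounded_of_bessel (f : Lambda R N r -> 'M[R[i]]_n) (b : R) : ell2 f -> 0 < b ->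
  (forall g, ell2 g ->
    (\esum_(l in [set: Lambda R N r]) (sqn (ell2_inner g (displace l f)))%:E
     <= (b * ell2_norm g ^+ 2)%:E)%E) ->
  {ae leb, forall x : R, Omega R N x ->
    mxnorm (fourier f x) <= Num.sqrt (4 * pi * N%:R * b / cos 1 ^+ 2)}.
Proof.
move=> f2 b0 fb; set K := 4 * pi * N%:R * b / cos 1 ^+ 2.
have pi0 := @pi_gt0 R; have cos1 := @cos1_gt0 R.
have N0 : 0 < N%:R :> R by rewrite ltr0n.
have K0 : 0 < K by rewrite divr_gt0 ?exprn_gt0// !mulr_gt0.
pose F x := mxsqn (fourier f x).
have F0 x : 0 <= F x by exact: mxsqn_ge0.
have mF : measurable_fun (Omega R N : set (measurableTypeR R)) F.
  exact: (measurable_fourier N_gt0 r_odd f2).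
pose w := F \_ (Omega R N).
have w0 x : 0 <= w x by rewrite /w patchE; case: ifP.
have mw : measurable_fun [set: measurableTypeR R] w.
  exact: (measurable_restrictT _ mO).1 mF.
have intF : leb.-integrable (Omega R N) (EFin \o F).
  apply/integrableP; split; first exact/measurable_EFinP.
  under eq_integral do rewrite /= ger0_norm//.
  by rewrite (matrix_parseval N_gt0 r_odd (fourier_entry N_gt0 r_odd f2)).
have intw : leb.-integrable [set: R] (EFin \o w).
  by rewrite /w -restrict_EFin; exact: (integrable_mkcond _ mO).1 intF.
have ball_le t M : (\int[leb]_(x in ball t ((8 * pi * N%:R * M.+1%:R)^-1)) (w x)%:E <=
    (K * ((8 * pi * N%:R * M.+1%:R)^-1 *+ 2))%:E)%E.
  have M0 : 0 < M.+1%:R :> R by rewrite ltr0n.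
  set rho := (_)^-1.
  pose P := multiplier (index_enum (evens M.+1)) (tuned t \o val) val.
  have mB : measurable (ball t rho : set (measurableTypeR R)) by exact: measurable_ball.
  have c0 : 0 < (cos 1 * M.+1%:R) ^+ 2 :> R by apply: exprn_gt0; exact: mulr_gt0.
  have mPF : measurable_fun (Omega R N : set (measurableTypeR R))
      (fun x => sqn (P x) * F x).
    by apply: measurable_funM => //; apply: measurable_sqn; exact: cmeas_multiplier.
  pose PF := (fun x => sqn (P x) * F x) \_ (Omega R N).
  have mPF' : measurable_fun [set: measurableTypeR R] PF.
    exact: (measurable_restrictT _ mO).1 mPF.
  have PF0 x : 0 <= PF x.
    by rewrite /PF patchE; case: ifP => // _; rewrite mulr_ge0 ?sqn_ge0.
  have step : (((cos 1 * M.+1%:R) ^+ 2)%:E * \int[leb]_(x in ball t rho) (w x)%:E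
      <= (b * M.+1%:R)%:E)%E.
    have mwB : measurable_fun (ball t rho : set (measurableTypeR R)) (fun x => (w x)%:E).
      by apply/measurable_EFinP; exact: measurable_funTS.
    rewrite -ge0_integralZl_EFin//; last 2 first.
    - by move=> x _; rewrite lee_fin.
    - exact: ltW.
    apply: (@le_trans _ _ (\int[leb]_(x in ball t rho) (PF x)%:E)%E).
      apply: ge0_le_integral => //.
      - by move=> x _; rewrite -EFinM lee_fin mulr_ge0// ltW.
      - exact: emeasurable_funM.
      - by apply/measurable_EFinP; exact: measurable_funTS.
      - move=> x; rewrite /ball /= distrC => xt.
        rewrite -EFinM lee_fin /PF /w !patchE; case: ifP => _; last by rewrite mulr0.
        by rewrite ler_wpM2r//; exact: multiplier_peak.
    apply: (@le_trans _ _ (\int[leb]_x (PF x)%:E)%E).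
      apply: ge0_subset_integral => //; first exact/measurable_EFinP.
      by move=> x _; rewrite lee_fin.
    rewrite (_ : (\int[leb]_x (PF x)%:E =
      \int[leb]_(x in Omega R N) (sqn (P x) * F x)%:E)%E); last first.
      by rewrite [RHS]integral_mkcond restrict_EFin.
    apply: le_trans (synthesis_bound N_gt0 r_odd f2 b0 fb (evens M.+1) (tuned t)) _.
    rewrite lee_fin (ler_wpM2l (ltW b0))// /partial_sum.
    under eq_bigr do rewrite sqn_expi.
    by rewrite sum_evens_const mul1r.
  rewrite -(@lee_pmul2l _ ((cos 1 * M.+1%:R) ^+ 2)%:E) ?lte_fin//.
  apply: le_trans step _; rewrite -EFinM lee_fin.
  rewrite le_eqVlt; apply/orP; left; apply/eqP; rewrite /K /rho.
  move: (pi : R) pi0 => q q0; field.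
  by apply/and4P; split; rewrite gt_eqF// nat1r ltr0n.
have := lebesgue_differentiation (open_integrable_locally openT intw).
apply: (@filterS _ _ (ae_filter_ringOfSetsType leb)) => t wt Ot.
have rho_cvg : (8 * pi * N%:R * M.+1%:R)^-1 @[M --> \oo] --> (0 : R).
  have H : (8 * pi * N%:R)^-1 * (M.+1%:R)^-1 @[M --> \oo] -->
      (8 * pi * N%:R)^-1 * (0 : R).
    by apply: cvgMl_tmp; exact: cvg_harmonic.
  by rewrite mulr0 in H; under eq_fun do rewrite invfM.
have rho0 M : 0 < (8 * pi * N%:R * M.+1%:R)^-1 :> R.
  by rewrite invr_gt0 !mulr_gt0// ltr0n.
have := lebesgue_pt_le w0 mw wt rho0 rho_cvg (ball_le t).
rewrite /w patchE mem_set// => FK.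
rewrite -(@ler_pXn2r _ 2)// ?nnegrE ?sqrtr_ge0//.
by rewrite sqr_mxnorm sqr_sqrtr// ltW.
Qed.

End BoundedSymbol.

(** * Bessel sequences and bounded transforms *)

Theorem corollary2p9 (R : realType) (n N r p : nat)
    (hn : (0 < n)%N) (hN : (0 < N)%N) (hr_odd : odd r) (hr_coprime : coprime r N)
    (hr : (1 <= r <= 2 * N - 1)%N) (hp : (0 < p)%N)
    (f : 'I_p -> Lambda R N r -> 'M[R[i]]_n)
    (hf : forall j, ell2 (f j)) (hf0 : forall j, f j <> cst 0) :
  Bessel f <->
  exists b0 : R, 0 < b0 /\
    forall j, {ae lebesgue_measure,
      forall x : R, Omega R N x -> mxnorm (fourier (f j) x) <= b0}.
Proof.
split=> [[b [b_gt0 fb]]|[b0 [b0_gt0 Fb]]].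
  exists (Num.sqrt (4 * pi * N%:R * b / cos 1 ^+ 2)); split.
    rewrite sqrtr_gt0 divr_gt0 ?exprn_gt0 ?cos1_gt0//.
    by rewrite !mulr_gt0 ?pi_gt0// ltr0n.
  move=> j; apply: (bounded_of_bessel hN hr_odd (hf j) b_gt0) => g g2.
  apply: le_trans (fb g g2); rewrite (bigD1 j)//= leeDl// sume_ge0// => i _.
  by apply: esum_ge0 => l _; rewrite lee_fin sqn_ge0.
exists (p%:R * b0 ^+ 2); split; first by rewrite mulr_gt0 ?exprn_gt0// ltr0n.
move=> g g2.
apply: (@le_trans _ _ (\sum_(j < p) (b0 ^+ 2 * ell2_norm g ^+ 2)%:E)%E).
  by apply: lee_sum => j _; exact: (bessel_of_bounded hN hr_odd (hf j) b0_gt0 (Fb j)).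
by rewrite sumEFin sumr_const card_ord -mulrA mulr_natl.
Qed.
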